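(* Let $X$ be an $n\times n$ Hermitian random matrix whose entries $X_{ij}=(X_{ji})^*$ are independent for $i\ge j$, with $X_{ij}\sim N_{\mathbb{C}}(0,b_{ij}^2)$ for $i>j$ and $X_{ii}\sim N_{\mathbb{R}}(0,b_{ii}^2)$, where $b_{ij}=b_{ji}\ge 0$ are arbitrary nonnegative scalars (not all zero). Let $$\sigma^2:=\max_{i\le n}\sum_{j\le n} b_{ij}^2,\qquad \sigma_*^2:=\max_{i,j\le n} b_{ij}^2.$$ Then $$\mathbf{P}\big[\|X\|>2\sigma+4\sigma_*^{4/3}\sigma^{-1/3}t\big]\le\frac{en\sigma_*^2}{\sigma^2}\,e^{-t^{3/2}}$$ for every $0\le t\le\frac{\sigma^{4/3}}{\sigma_*^{4/3}}$.
   Context: $N_{\mathbb{R}}(0,s^2)$ is the real centered Gaussian law with variance $s^2$. $N_{\mathbb{C}}(0,s^2)$ is the law of a complex random variable whose real and imaginary parts are independent with law $N_{\mathbb{R}}(0,s^2/2)$. For a scalar, $a^*$ is the complex conjugate. $\|X\|$ is the spectral norm (largest singular value). $\sigma,\sigma_*$ denote the nonnegative square roots, and $e$ is Euler's number. *)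

(* Defs.v *)
From HB Require Import structures.
From mathcomp Require Import all_boot all_order all_algebra.
From mathcomp Require Import all_classical all_reals all_analysis.
From mathcomp Require Import complex.

Set Implicit Arguments.
Unset Strict Implicit.
Unset Printing Implicit Defensive.

Import Order.TTheory GRing.Theory Num.Theory.

Local Open Scope classical_set_scope.
Local Open Scope complex_scope.
Local Open Scope ring_scope.

(* The centered Gaussian law of variance [v]. [normal_prob m s] takes the
   standard deviation [s] and is the uniform law on [0, 1] when [s = 0]; the
   degenerate Gaussian law is the Dirac mass at [0]. *)
Definition normalR (R : realType) (v : R) : probability (measurableTypeR R) R :=
  if v == 0 then (dirac (0 : measurableTypeR R) : probability _ R)
  else (normal_prob 0 (Num.sqrt v) : probability _ R).

Definition has_law (R : realType) (d d' : measure_display)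
    (T : measurableType d) (S : measurableType d') (P : probability T R)
    (Y : T -> S) (mu : set S -> \bar R) : Prop :=
  measurable_fun setT Y /\
  forall A : set S, measurable A -> P (Y @^-1` A) = mu A.

(* Mutual independence of the finite family [Y k], [k] in [D]: the product rule
   holds for every subfamily. *)
Definition mutually_independent (R : realType) (d d' : measure_display)
    (T : measurableType d) (S : measurableType d') (P : probability T R)
    (I : finType) (D : {set I}) (Y : I -> T -> S) : Prop :=
  forall (J : {set I}) (B : I -> set S),
    J \subset D -> (forall k, measurable (B k)) ->
    P (\bigcap_(k in [set` J]) Y k @^-1` B k) =
    (\prod_(k in J) P (Y k @^-1` B k))%E.

Definition independent2 (R : realType) (d d1 d2 : measure_display)
    (T : measurableType d) (S1 : measurableType d1) (S2 : measurableType d2)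
    (P : probability T R) (Y : T -> S1) (Z : T -> S2) : Prop :=
  forall (A : set S1) (B : set S2), measurable A -> measurable B ->
    P (Y @^-1` A `&` Z @^-1` B) = (P (Y @^-1` A) * P (Z @^-1` B))%E.

(* The measurable structure on the complex numbers is that of R * R. *)
Definition reim (R : realType) (z : R[i]) :
    measurableTypeR R * measurableTypeR R :=
  (complex.Re z, complex.Im z).

Definition normalC_law (R : realType) (d : measure_display)
    (T : measurableType d) (P : probability T R) (Z : T -> R[i]) (v : R) : Prop :=
  let ReZ : T -> measurableTypeR R := fun w => complex.Re (Z w) in
  let ImZ : T -> measurableTypeR R := fun w => complex.Im (Z w) in
  [/\ has_law P ReZ (normalR (v / 2)), has_law P ImZ (normalR (v / 2))
    & independent2 P ReZ ImZ].

(* A complex variable has a real Gaussian law when it is real and its real part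
   has that law. *)
Definition normalR_law (R : realType) (d : measure_display)
    (T : measurableType d) (P : probability T R) (Z : T -> R[i]) (v : R) : Prop :=
  (forall w, complex.Im (Z w) = 0) /\
  has_law P (fun w => complex.Re (Z w) : measurableTypeR R) (normalR v).

Definition singular_values (R : realType) (m n : nat) (A : 'M[R[i]]_(m, n)) :
    set R :=
  [set s | 0 <= s /\ eigenvalue (A ^t* *m A)%sesqui ((s ^+ 2)%:C)].

(* A finite set of reals, nonempty as soon as [n > 0], so that [sup] is its
   maximum. *)
Definition spectral_norm (R : realType) (m n : nat) (A : 'M[R[i]]_(m, n)) : R :=
  sup (singular_values A).

Definition sigma (R : realType) (n : nat) (b : 'I_n -> 'I_n -> R) : R :=
  Num.sqrt (\big[Num.max/0]_(i < n) \sum_(j < n) b i j ^+ 2).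

Definition sigma_star (R : realType) (n : nat) (b : 'I_n -> 'I_n -> R) : R :=
  Num.sqrt (\big[Num.max/0]_(i < n) \big[Num.max/0]_(j < n) b i j ^+ 2).

(* Main.v *)
Require Import Defs.
From HB Require Import structures.
From mathcomp Require Import all_boot all_order all_algebra all_fingroup.
From mathcomp Require Import all_classical all_reals all_analysis.
From mathcomp Require Import measurable_realfun complex.
From mathcomp Require Import zify ring lra.

(* For Hermitian [X], [spectral_norm X ^ 2p <= tr (X ^ 2p)], so it is enough to
   bound the moments [E tr (X ^ 2p)] and to apply Markov's inequality.

   By Wick's formula, [E tr (X ^ 2p)] is a sum over the pairings [a] of the sides
   of a [2p]-gon; the contribution of [a] is a sum over the labellings by [n] of
   the vertices of the map obtained by gluing the sides along [a]. If that map
   has [V] vertices, exploring it along the polygon discovers [V - 1] new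
   vertices, each of which costs [sigma ^ 2]; the other [p + 1 - V] edges cost at
   most [sigma_star ^ 2] each. Hence, with [x := sigma_star ^ 2 / sigma ^ 2],
   [E tr (X ^ 2p) <= n sigma ^ 2p sum_a x ^ (p + 1 - V a)].

   The pairings are counted by genus [g], where [V = p + 1 - 2g], following
   Chapuy: a map of genus [g] has exactly [2g] trisections, and a vertex can be
   cut into three at each of them, which lowers the genus by one and is injective
   once the three sides are recorded. So [2g E_g <= C(2p, 3) E_(g-1)], where [E_0]
   is at most the Catalan number; therefore
   [sum_a x ^ (p + 1 - V a) <= Cat_p exp (C(2p, 3) x ^ 2 / 2)].
   Markov's inequality with [p] the integer following [x ^ (-2/3) sqrt t]
   concludes for [t > 1]; for [t <= 1] the bound is at least [1]. *)

Set Implicit Arguments.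
Unset Strict Implicit.
Unset Printing Implicit Defensive.

Import Order.TTheory GRing.Theory Num.Theory.

(** * Pairings of the sides of a polygon *)

(** [E (X i j * X k l)] vanishes unless [(k, l) = (j, i)], because the square of an off-diagonal
    entry has mean zero. So Wick's formula glues sides in opposite directions only, and every map is
    orientable.

    No topology is used: the genus is read off from the number of cycles of a permutation, and
    pairings are graded by the [t] with [V + t = p + 1]. That [t] is even is itself deduced from
    trisections.

    The order [p] is the optimal one. Put [y := x ^ (-2/3)] and [s := sqrt t]. The threshold is
    [2 sigma (1 + 2 s ^ 2 / y)], at least [2 sigma exp (s ^ 2 / y)] because [t <= y]. To leading
    order Markov's inequality leaves the exponent [(2/3) (p / y) ^ 3 - 2 p s ^ 2 / y], which is
    least at [p = y s], where it equals [- (4/3) s ^ 3]. The spare [s ^ 3 / 3], together with the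
    factor [e] of the theorem, pays for rounding [p] and for the terms of lower order.

    The factor [sigma_star ^ 2 / sigma ^ 2] of the theorem comes from the decay of Catalan numbers
    relative to [4 ^ p]: [Cat_p <= 4 ^ p p ^ (-3/2)], and [p >= y] gives [p ^ (-3/2) <= x]. *)

Section Porbits.
Variable T : finType.
Implicit Types (s r : {perm T}).
Local Open Scope group_scope.

Lemma porbit_mem_closed s (A : {set T}) x :
  x \in A -> (forall y, y \in A -> s y \in A) -> porbit s x \subset A.
Proof.
move=> xA sA; apply/fintype.subsetP => y /porbitP [i ->].
by elim: i => [|i IH]; rewrite ?expg0 ?perm1 // expgSr permM sA.
Qed.

Lemma porbit_conj s r x : porbit (s ^ r) (r x) = r @: porbit s x.
Proof.
have step i : ((s ^ r) ^+ i) (r x) = r ((s ^+ i) x).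
  by rewrite -conjXg conjgE !permM permK.
apply/setP => y; apply/porbitP/imsetP => [[i ->]|[z /porbitP [i ->] ->]].
  by exists ((s ^+ i) x); [exact: mem_porbit | exact: step].
by exists i; rewrite step.
Qed.

Lemma card_porbits_conj s r : #|porbits (s ^ r)| = #|porbits s|.
Proof.
have -> : porbits (s ^ r) = [set r @: (B : {set T}) | B in porbits s].
  apply/setP => B; apply/imsetP/imsetP => [[x _ ->]|[C /imsetP [x _ ->] ->]].
    exists (porbit s (r^-1 x)); first exact: imset_f.
    by rewrite -porbit_conj permKV.
  by exists (r x); rewrite ?porbit_conj.
by rewrite card_imset //; apply: imset_inj; exact: perm_inj.
Qed.

(* [u] sends [z] to [y]: multiplying by two transpositions first makes [y] a
   fixed point, then cuts the rest of the cycle between [x] and [z]. *)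
Lemma card_porbits_split3 (u : {perm T}) x y z :
    x \in porbit u z -> u z = y -> x != y -> y != z -> x != z ->
  #|porbits (tperm x z * (tperm y z * u))| = #|porbits u| + 2.
Proof.
move=> xz uz nxy nyz nxz.
have yz : y \in porbit u z by rewrite -uz (mem_porbit u 1).
have := porbits_mul_tperm u y z; rewrite /= yz nyz addn0 => E1.
have := porbits_mul_tperm (tperm y z * u) x z; rewrite /= nxz E1.
suff -> : x \in porbit (tperm y z * u) z by rewrite addn0 => ->; rewrite -addnA.
set v := tperm y z * u.
have vz : v z = u y by rewrite /v permM tpermR.
have sub : porbit u z \subset y |: porbit v z.
  apply: porbit_mem_closed; first by rewrite !inE porbit_id orbT.
  move=> w; rewrite !inE => /orP [/eqP ->|wz].
    by rewrite -vz (mem_porbit v 1) orbT.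
  have [->|nwz] := eqVneq w z; first by rewrite uz eqxx.
  have [->|nwy] := eqVneq w y; first by rewrite -vz (mem_porbit v 1) orbT.
  have -> : u w = v w by rewrite /v permM tpermD // eq_sym.
  apply/orP; right; rewrite -eq_porbit_mem in wz; rewrite -(eqP wz).
  exact: (mem_porbit v 1).
by have := fintype.subsetP sub _ xz; rewrite !inE (negPf nxy).
Qed.

End Porbits.

Section CycleMinima.
Variable m : nat.
Implicit Types (s : {perm 'I_m}) (x y : 'I_m).

(** The least element represents its cycle: a vertex of the map is counted at the corner where the
    tour of the polygon first meets it. *)
Definition cycle_minima s : {set 'I_m} :=
  [set x | [forall y in porbit s x, x <= y]].

Lemma cycle_minP s x :
  reflect (forall y, y \in porbit s x -> x <= y) (x \in cycle_minima s).
Proof. by rewrite inE; exact: forall_inP. Qed.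

Lemma ex_cycle_min s x : {y | y \in porbit s x & y \in cycle_minima s}.
Proof.
pose y := [arg min_(y < x in porbit s x) (y : nat)].
exists y; rewrite /y; case: arg_minnP; rewrite ?porbit_id // => z zx zmin.
apply/cycle_minP => w wz; apply: zmin.
by rewrite -eq_porbit_mem in zx; rewrite -(eqP zx).
Qed.

Lemma cycle_min_uniq s x y :
  x \in cycle_minima s -> y \in cycle_minima s -> x \in porbit s y -> x = y.
Proof.
move=> /cycle_minP mx /cycle_minP my xy; apply: val_inj; apply/eqP.
by rewrite eqn_leq mx ?my // porbit_sym.
Qed.

Lemma card_cycle_minima s : #|cycle_minima s| = #|porbits s|.
Proof.
have <- : [set porbit s x | x in cycle_minima s] = porbits s.
  apply/setP => B; apply/imsetP/imsetP => [[x _ ->]|[x _ ->]]; first by exists x.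
  have [y yx my] := ex_cycle_min s x; exists y => //.
  by apply/esym/eqP; rewrite eq_porbit_mem.
rewrite card_in_imset // => x y mx my /eqP; rewrite eq_porbit_mem.
exact: cycle_min_uniq.
Qed.

End CycleMinima.

Section Pairings.
Local Open Scope group_scope.

Definition cshift m : {perm 'I_m} := perm (@ordS_inj m).

Lemma cshiftE m (x : 'I_m) :
  cshift m x = (if x.+1 == m then 0 else x.+1)%N :> nat.
Proof.
rewrite permE /=; have [->|ne] := eqVneq; first by rewrite modnn.
by rewrite modn_small // ltn_neqAle ne ltn_ord.
Qed.

Definition pairings m : {set {perm 'I_m}} :=
  [set a : {perm 'I_m} | [forall x, (a (a x) == x) && (a x != x)]].

Lemma pairingsP m (a : {perm 'I_m}) :
  reflect (involutive a /\ forall x, a x != x) (a \in pairings m).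
Proof.
rewrite inE; apply: (iffP forallP) => [H|[H1 H2] x]; last by rewrite H1 H2 eqxx.
by split=> x; have /andP [/eqP] := H x.
Qed.

(* The cycles of [vertices a] are the vertices of the map obtained from the
   [m]-gon by gluing its sides along [a]. *)
Definition vertices m (a : {perm 'I_m}) : {perm 'I_m} := a * cshift m.

Lemma verticesE m (a : {perm 'I_m}) x :
  vertices a x = (if (a x).+1 == m then 0 else (a x).+1)%N :> nat.
Proof. by rewrite permM cshiftE. Qed.

Definition openers m (a : {perm 'I_m}) : {set 'I_m} := [set x : 'I_m | x < a x].

Lemma card_openers p (a : {perm 'I_p.*2}) :
  a \in pairings p.*2 -> #|openers a| = p.
Proof.
case/pairingsP => aa na.
have E : ~: openers a = [set a x | x in openers a].
  apply/setP => y; rewrite !inE -leqNgt; apply/idP/imsetP => [le|[x]].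
    exists (a y); rewrite ?aa // inE aa ltn_neqAle le andbT.
    by apply: contraNneq (na y) => /val_inj ->.
  by rewrite inE => lt ->; rewrite aa ltnW.
have := cardsC (openers a).
by rewrite E card_imset ?card_ord; [lia | exact: perm_inj].
Qed.

(** The descents of the vertex permutation that do not lead to the least element of a cycle. A fixed
    point is a weak descent, but it is its own minimum and so never a trisection. *)
Definition trisections m (a : {perm 'I_m}) : {set 'I_m} :=
  [set x : 'I_m | (vertices a x <= x) &&
                  (vertices a x \notin cycle_minima (vertices a))].

(** The weak descents are counted in two ways. They are the [p] sides that come after their
    partners, and the partner of the last side, where the tour wraps to [0]. On the other hand each
    side sent to a cycle minimum is a descent, which makes one per vertex, and the other descents
    are the trisections. *)
Lemma card_trisections p (a : {perm 'I_p.*2}) : 0 < p -> a \in pairings p.*2 ->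
  #|trisections a| + #|porbits (vertices a)| = p.+1.
Proof.
move=> p0 pa; have /pairingsP [aa na] := pa.
have lt_last : p.*2.-1 < p.*2 by lia.
pose l : 'I_p.*2 := Ordinal lt_last.
set s := vertices a.
pose D := [set x : 'I_p.*2 | s x <= x].
have DE : D = a l |: ~: openers a.
  apply/setP => x; rewrite !inE verticesE -leqNgt.
  have := na x; rewrite -val_eqE /= => nax.
  have := ltn_ord (a x) => ltx.
  case: ifPn => [/eqP axl|axl].
    have -> : x == a l by rewrite -(aa x) (inj_eq perm_inj) -val_eqE /=; lia.
    by [].
  have -> : (x == a l) = false.
    by rewrite -(aa x) (inj_eq perm_inj) -val_eqE /=; apply/eqP; lia.
  by move: nax => /=; lia.
have alO : a l \in openers a.
  rewrite inE aa; have := na l; rewrite -val_eqE /=; have := ltn_ord (a l); lia.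
have cD : #|D| = p.+1.
  rewrite DE cardsU1 finset.in_setC alO /=; have := cardsC (openers a).
  rewrite card_ord (card_openers pa); move: #|~: openers a| => k; lia.
rewrite -card_cycle_minima -cD -(cardsID (s @^-1: cycle_minima s) D) addnC.
congr (_ + _)%N.
  transitivity #|s @^-1: cycle_minima s|.
    by rewrite card_preimset //; exact: perm_inj.
  congr #|pred_of_set _|; apply/setP => x; rewrite !inE.
  case H: [forall _ in _, _] => /=; rewrite ?andbF // andbT.
  move/forall_inP: H => -> //; rewrite porbit_sym; exact: (mem_porbit s 1).
by apply: eq_card => x; rewrite !inE andbC.
Qed.

End Pairings.

(** * Cutting a vertex at a trisection *)

Section Cutting.
Local Open Scope group_scope.
Variable m : nat.
Implicit Types (x y z : 'I_m) (a r : {perm 'I_m}).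

(** The exchange of the adjacent blocks that start at [x] and at [z], the second one ending before
    [y]. *)
Definition block_swap (x z y i : nat) : nat :=
  if (i < x)%N then i else if (i < z)%N then (i + (y - z))%N
  else if (i < y)%N then (i - (z - x))%N else i.

(** The swap changes successors on the tour only where a block begins: the side that led to [x] now
    leads to [z], the one that led to [z] leads to [y], and the one that led to [y] leads to [x].
    The nested conditional is this 3-cycle. *)
Lemma block_swap_succ (x z y i : nat) : x < z -> z < y -> y < m -> i < m ->
  let j := if i.+1 == m then 0%N else i.+1 in
  block_swap x z y
    (if j == y then x else if j == z then y else if j == x then z else j)
  = (if (block_swap x z y i).+1 == m then 0 else (block_swap x z y i).+1)%N.
Proof.
move=> xz zy ym im; rewrite /block_swap.
have [Em|nm] := eqVneq i.+1 m => /=.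
  have -> : (i < x)%N = false by lia.
  have -> : (i < z)%N = false by lia.
  have -> : (i < y)%N = false by lia.
  (* The wrap to [0] meets a moved block only if [x = 0]; the new tour then starts at [z]. *)
  rewrite Em eqxx; have [->|n0] := eqVneq x 0%N.
    have -> : (0 == y)%N = false by lia.
    have -> : (0 == z)%N = false by lia.
    by rewrite ltn0 ltnn zy subn0 subnn.
  have -> : (0 == y)%N = false by lia.
  have -> : (0 == z)%N = false by lia.
  by have -> : (0 < x)%N by lia.
have [lt1|lt1] := ltnP i x.
  rewrite (negPf nm); have -> : (i.+1 == y)%N = false by lia.
  have -> : (i.+1 == z)%N = false by lia.
  have [E|ne] := eqVneq i.+1 x.
    have -> : (z < x)%N = false by lia.
    by rewrite ltnn zy; lia.
  by have -> : (i.+1 < x)%N by lia.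
have [lt2|lt2] := ltnP i z.
  have -> : ((i + (y - z)).+1 == m)%N = false by lia.
  have -> : (i.+1 == y)%N = false by lia.
  have [E|ne] := eqVneq i.+1 z.
    have -> : (y < x)%N = false by lia.
    have -> : (y < z)%N = false by lia.
    by rewrite ltnn; lia.
  have -> : (i.+1 == x)%N = false by lia.
  have -> : (i.+1 < x)%N = false by lia.
  by have -> : (i.+1 < z)%N by lia.
have [lt3|lt3] := ltnP i y.
  have -> : ((i - (z - x)).+1 == m)%N = false by lia.
  have [E|ne] := eqVneq i.+1 y.
    by rewrite ltnn xz; lia.
  have -> : (i.+1 == z)%N = false by lia.
  have -> : (i.+1 == x)%N = false by lia.
  have -> : (i.+1 < x)%N = false by lia.
  have -> : (i.+1 < z)%N = false by lia.
  have -> : (i.+1 < y)%N by lia.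
  by lia.
rewrite (negPf nm); have -> : (i.+1 == y)%N = false by lia.
have -> : (i.+1 == z)%N = false by lia.
have -> : (i.+1 == x)%N = false by lia.
have -> : (i.+1 < x)%N = false by lia.
have -> : (i.+1 < z)%N = false by lia.
by have -> : (i.+1 < y)%N = false by lia.
Qed.

Definition is_block_swap x z y r := [forall i, r i == block_swap x z y i :> nat].

Lemma ex_block_swap x z y : x < z -> z < y -> exists r, is_block_swap x z y r.
Proof.
move=> xz zy.
have lt (i : 'I_m) : block_swap x z y i < m.
  by rewrite /block_swap; have := ltn_ord i; have := ltn_ord y; do !case: ifP; lia.
have inj : injective (fun i : 'I_m => Ordinal (lt i)).
  move=> i j [] E; apply: val_inj => /=; move: E; rewrite /block_swap.
  by do !case: ifP; lia.
by exists (perm inj); apply/forallP => i; rewrite permE.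
Qed.

Lemma block_swap_shift x z y r : x < z -> z < y -> is_block_swap x z y r ->
  cshift m * (tperm y z * tperm x z) * r = r * cshift m.
Proof.
move=> xz zy /forallP rE; have {}rE (i : 'I_m) : r i = block_swap x z y i :> nat by apply/eqP.
apply/permP => i; apply: ord_inj; rewrite !permM rE cshiftE rE.
set j := cshift m i.
have jE : j = (if i.+1 == m then 0 else i.+1)%N :> nat by rewrite cshiftE.
have Ec : tperm x z (tperm y z j)
   = (if j == y then x else if j == z then y else if j == x then z else j).
  have [->|jy] := eqVneq j y.
    by rewrite tpermL tpermR.
  have [->|jz] := eqVneq j z.
    by rewrite tpermR tpermD // -val_eqE /=; lia.
  have [->|jx] := eqVneq j x.
    by rewrite (@tpermD _ y z x) ?tpermL // -val_eqE /=; lia.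
  by rewrite !tpermD // eq_sym.
rewrite Ec; have := block_swap_succ xz zy (ltn_ord y) (ltn_ord i).
rewrite /= -jE => <-; congr block_swap.
have E (w : 'I_m) : (j == w) = (j == w :> nat) by [].
rewrite !E; do 3?[case: ifP => //= _].
Qed.

(* Cuts the vertex of the trisection [y] into three vertices; the conjugation
   by the block swap relabels the sides in the order of the new tour. *)
Lemma card_porbits_cut a x y z r :
    x < z -> z < y -> is_block_swap x z y r ->
    vertices a y = z -> x \in porbit (vertices a) z ->
  #|porbits (vertices (a ^ r))| = (#|porbits (vertices a)| + 2)%N.
Proof.
move=> xz zy rs yz xp.
have -> : vertices (a ^ r) = (vertices a * (tperm y z * tperm x z)) ^ r.
  rewrite /vertices !conjgE -!mulgA; do 2 congr (_ * _).
  by rewrite -(block_swap_shift xz zy rs) -!mulgA.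
(* [card_porbits_split3] has its transpositions on the left, so it is applied to the inverse of
   [vertices a], which sends [z] to [y]. *)
rewrite card_porbits_conj -porbitsV invMg invMg !tpermV -mulgA.
rewrite card_porbits_split3 ?porbitsV ?porbitV //.
- by rewrite -yz permK.
- by rewrite -val_eqE /=; lia.
- by rewrite -val_eqE /=; lia.
- by rewrite -val_eqE /=; lia.
Qed.

Lemma pairings_conj a r : a \in pairings m -> a ^ r \in pairings m.
Proof.
move=> /pairingsP [aa na]; apply/pairingsP; rewrite conjgE.
split=> x; rewrite !permM ?permK ?aa ?permKV //.
by rewrite -{2}(permKV r x) (inj_eq perm_inj) na.
Qed.

(** The three corners at which the vertex of [y] is cut: its least element and the two ends of the
    descent from [y]. *)
Definition cut_triple a y : 'I_m * 'I_m * 'I_m :=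
  (s2val (ex_cycle_min (vertices a) (vertices a y)), vertices a y, y).

(** Both inequalities are strict because [vertices a y] is not a cycle minimum: it differs from the
    minimum, and it differs from [y], since a fixed point would be minimal. *)
Lemma cut_tripleP a y (q := cut_triple a y) : y \in trisections a ->
  [/\ q.1.1 < q.1.2, q.1.2 < q.2, q.2 = y, q.1.2 = vertices a y
    & q.1.1 \in porbit (vertices a) q.1.2].
Proof.
rewrite inE /q /cut_triple /=; case: (ex_cycle_min _ _) => x /= xp xm.
set s := vertices a => /andP [le nm]; split => //.
  rewrite ltn_neqAle (cycle_minP _ _ xm) 1?porbit_sym // andbT.
  by apply: contraNneq nm => /val_inj <-.
rewrite ltn_neqAle le andbT; apply: contraNneq nm => /val_inj syy.
apply/cycle_minP => w /porbitP [i ->].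
suff -> : (s ^+ i) (s y) = s y by [].
by rewrite syy; elim: i => [|i IH]; rewrite ?expg0 ?perm1 // expgSr permM IH.
Qed.

(** A function of the triple alone, which makes the cut reversible. The default [1] is not reached
    on increasing triples. *)
Definition relabel (q : 'I_m * 'I_m * 'I_m) : {perm 'I_m} :=
  odflt 1 [pick r | is_block_swap q.1.1 q.1.2 q.2 r].

Lemma relabelP (q : 'I_m * 'I_m * 'I_m) : q.1.1 < q.1.2 -> q.1.2 < q.2 ->
  is_block_swap q.1.1 q.1.2 q.2 (relabel q).
Proof.
move=> lt1 lt2; rewrite /relabel; case: pickP => //= none.
by have [r] := ex_block_swap lt1 lt2; rewrite none.
Qed.

Lemma card_increasing_triples :
  #|[set q : 'I_m * 'I_m * 'I_m | (q.1.1 < q.1.2) && (q.1.2 < q.2)]| = 'C(m, 3).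
Proof.
rewrite -card_ltn_sorted_tuples.
pose f (q : 'I_m * 'I_m * 'I_m) := [tuple q.1.1; q.1.2; q.2].
have f_inj : injective f.
  by move=> [[x1 x2] x3] [[y1 y2] y3] /(congr1 val) /= [-> -> ->].
rewrite -(card_imset _ f_inj); apply: eq_card => t; rewrite [RHS]inE.
apply/imsetP/idP => [[[[x z] y]] | ].
  by rewrite inE /= => /andP [xz zy] -> /=; rewrite xz zy.
case: t => [[|x [|z [|y []]]]] //= sz /and3P [xz zy _].
by exists (x, z, y); rewrite ?inE /= ?xz ?zy //; apply: val_inj.
Qed.

End Cutting.

(** * Pairings graded by genus *)

Section Layers.
Variable p : nat.
Hypothesis p_gt0 : 0 < p.

(* [layer (2 * g)] is the set of pairings of genus [g], by Euler's formula. *)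
Definition layer t : {set {perm 'I_p.*2}} :=
  [set a in pairings p.*2 | #|porbits (vertices a)| + t == p.+1].

Lemma layer_trisections t a : a \in layer t -> #|trisections a| = t.
Proof.
by rewrite inE => /andP [pa /eqP E]; have := card_trisections p_gt0 pa; lia.
Qed.

Lemma layer_step t : t.+2 * #|layer t.+2| <= 'C(p.*2, 3) * #|layer t|.
Proof.
pose S := [set q : {perm 'I_p.*2} * 'I_p.*2 | (q.1 \in layer t.+2) && (q.2 \in trisections q.1)].
have -> : (t.+2 * #|layer t.+2| = #|S|)%N.
  rewrite mulnC -sum_nat_const /S -sum1dep_card.
  rewrite -(pair_big_dep (fun a => a \in layer t.+2) (fun a x => x \in trisections a) (fun _ _ => 1))%N /=.
  by apply: eq_bigr => a aL; rewrite sum1_card (layer_trisections aL).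
rewrite -card_increasing_triples -cardsX.
pose f (q : {perm 'I_p.*2} * 'I_p.*2) :=
  (cut_triple q.1 q.2, (q.1 ^ relabel (cut_triple q.1 q.2))%g).
(* The triple fixes the relabelling, so the pairing is recovered by undoing the conjugation; the
   trisection is the last entry of the triple. *)
have f_inj : {in S &, injective f}.
  move=> [a y] [a' y'] _ _ /= E.
  have E1 : cut_triple a y = cut_triple a' y' := congr1 fst E.
  have /= := congr1 snd E; rewrite E1 => /conjg_inj ->.
  by have /= -> := congr1 snd E1.
rewrite -(card_in_imset f_inj); apply/subset_leq_card/fintype.subsetP => w /imsetP [[a y]].
rewrite inE /= => /andP [aL yT] ->.
have [lt1 lt2 Ey Ez xp] := cut_tripleP yT.
have /andP [pa /eqP E] : (a \in pairings p.*2) && (#|porbits (vertices a)| + t.+2 == p.+1).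
  by move: aL; rewrite [_ \in layer _]inE.
rewrite finset.in_setX; apply/andP; split; first by rewrite inE lt1 lt2.
rewrite /= inE pairings_conj //=.
by rewrite (card_porbits_cut lt1 lt2 (relabelP lt1 lt2)) ?Ey //; apply/eqP; lia.
Qed.

(** Cutting at its only trisection would turn [p] vertices into [p + 2], more than a pairing can
    have. *)
Lemma layer1 : layer 1 = finset.set0.
Proof.
apply/setP => a; rewrite finset.in_set0; apply/negbTE/negP => aL.
have /card_gt0P [y yT] : 0 < #|trisections a| by rewrite (layer_trisections aL).
have [lt1 lt2 Ey Ez xp] := cut_tripleP yT.
have := card_porbits_cut lt1 lt2 (relabelP lt1 lt2) _ xp.
rewrite Ey => /(_ (esym Ez)).
move: aL; rewrite inE => /andP [pa /eqP E].
by have := card_trisections p_gt0 (pairings_conj (relabel (cut_triple a y)) pa); lia.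
Qed.

End Layers.

(** * Planar pairings *)

Section Ballot.

Fixpoint ballot (h : nat) (s : seq bool) : bool :=
  match s with
  | [::] => h == 0
  | true :: s' => ballot h.+1 s'
  | false :: s' => (0 < h) && ballot h.-1 s'
  end.

Definition nb_ballot m h := #|[set t : m.-tuple bool | ballot h t]|.

Lemma nb_ballotS m h :
  nb_ballot m.+1 h = nb_ballot m h.+1 + (if 0 < h then nb_ballot m h.-1 else 0).
Proof.
pose f (q : bool * m.-tuple bool) := [tuple of q.1 :: q.2].
have f_inj : injective f by move=> [b t] [b' t'] /(congr1 val) /= [-> /val_inj ->].
have f_bij : bijective f.
  by apply: inj_card_bij => //; rewrite card_prod !card_tuple card_bool expnS.
rewrite /nb_ballot -!sum1dep_card (reindex f) /=; last exact: onW_bij.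
rewrite -(pair_big_dep xpredT (fun b (t : m.-tuple bool) => ballot h (b :: t)) (fun _ _ => 1)) /=.
rewrite big_bool /=; congr (_ + _); case: ifP => _ //=.
by rewrite big_pred0.
Qed.

Lemma nb_ballot_small m h : m < h -> nb_ballot m h = 0.
Proof.
elim: m h => [|m IH] h lt.
  rewrite /nb_ballot; apply: eq_card0 => t; rewrite inE tuple0 /=.
  by apply/negbTE; rewrite -lt0n.
rewrite nb_ballotS IH; last lia.
by case: ifP => // _; apply: IH; lia.
Qed.

(** The ballot theorem, free of division: [true] is a step up, [false] a step down, and a path from
    height [h] to [0] with [u] steps up has length [u.*2 + h]. Induction on the length, by the
    choice of the first step. *)
Lemma nb_ballot_bin u h :
  (h + u).+1 * nb_ballot (u.*2 + h) h = h.+1 * 'C(u.*2 + h, u).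
Proof.
move Em : (u.*2 + h)%N => m; elim: m u h Em => [|m IH] u h Em.
  have [-> ->] : u = 0 /\ h = 0 by lia.
  rewrite bin0 /nb_ballot; have -> : #|[set t : 0.-tuple bool | ballot 0 t]| = 1 => //.
  by apply: (@fintype.eq_card1 _ [tuple]) => t; rewrite [t]tuple0 !inE eqxx.
rewrite nb_ballotS.
case: u Em => [|u] Em.
  rewrite nb_ballot_small ?bin0; last lia.
  case: h Em => [|h] Em; first by lia.
  have E0 : 0.*2 + h = m by lia.
  have /eqP := IH 0 h E0; rewrite bin0 addn0 eqn_pmul2l // => /eqP /= ->; lia.
have := IH u h.+1; rewrite (_ : u.*2 + h.+1 = m); last lia.
move=> /(_ erefl) E1.
have E3 : u.+1 * 'C(m, u.+1) = (h + u.+1) * 'C(m, u).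
  by rewrite mul_bin_left; congr (_ * _); lia.
rewrite binS; case: h Em E1 E3 => [|h] Em E1 E3.
  rewrite addn0; move: E1 E3; rewrite /= => E1 /eqP.
  rewrite add0n eqn_pmul2l // => /eqP ->; move: E1; lia.
have := IH u.+1 h; rewrite (_ : u.+1.*2 + h = m); last lia.
move=> /(_ erefl) /= E2; apply/eqP; rewrite -(eqn_pmul2l (m := (h + u.+1).+1)) //; apply/eqP.
move: E1 E2 E3; move: (nb_ballot m h.+2) (nb_ballot m h) 'C(m, u) 'C(m, u.+1).
move=> x y z w E1 E2 E3; nia.
Qed.

Lemma nb_ballot_catalan p : p.+1 * nb_ballot p.*2 0 = 'C(p.*2, p).
Proof. by have := nb_ballot_bin p 0; rewrite add0n addn0 mul1n. Qed.

End Ballot.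

Section Planar.
Variable m : nat.
Implicit Types (a : {perm 'I_m}) (k x : 'I_m).

(** Without trisections the pairing has no crossing. The cycle through [k + 1] and [l := a k] has
    [k + 1] as its minimum and only one descent, at [l]; so it climbs from [k + 1] to [l], and its
    steps cut the interval into shorter chords, to which induction applies. *)
Lemma planar_nested a k x : a \in pairings m -> trisections a = finset.set0 ->
  k < x -> x < a k -> (k < a x) && (a x < a k).
Proof.
case/pairingsP => aa na tri0; set s := vertices a.
have descent y : s y <= y -> s y \in cycle_minima s.
  by move=> le; have := finset.in_set0 y; rewrite -tri0 inE le => /negbT; rewrite negbK.
have [n] := ubnP (a k - k); elim: n k x => // n IH k x lt_n kx xk.
set l := a k in xk lt_n *; pose b := s l.
have bE : b = k.+1 :> nat.
  by rewrite /b verticesE aa; case: ifP => // /eqP E; have := ltn_ord x; lia.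
have bm : b \in cycle_minima s by apply: descent; rewrite -/b bE; lia.
have sb y : y \in porbit s b -> s y <= y -> y = l.
  move=> yb le; apply: (@perm_inj _ s); apply: (cycle_min_uniq (descent _ le) bm).
  rewrite -/b -eq_porbit_mem; rewrite -eq_porbit_mem in yb; rewrite -(eqP yb).
  exact/eqP/(porbit_perm s 1).
have sP y : y \in porbit s b -> s y \in porbit s b.
  by rewrite -!eq_porbit_mem => /eqP <-; apply/eqP/(porbit_perm s 1).
have le_l y : y \in porbit s b -> y <= l.
  pose M := [arg max_(z > b in porbit s b) (z : nat)].
  have [Mb Mmax] : M \in porbit s b /\ forall z, z \in porbit s b -> z <= M.
    by rewrite /M; case: arg_maxnP; rewrite ?porbit_id.
  by have <- : M = l by [apply: sb => //; exact/Mmax/sP]; exact: Mmax.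
(* The last element of the cycle up to [x]. As [s c] is the successor of [a c], [x] lies between [c]
   and [a c], and this chord is strictly inside the one from [k] to [l]. *)
pose c := [arg max_(z > b | (z \in porbit s b) && (z <= x)) (z : nat)].
have [cb cx cmax] : [/\ c \in porbit s b, c <= x &
    forall z, z \in porbit s b -> z <= x -> z <= c].
  rewrite /c; case: arg_maxnP => [|c' /andP [c1 c2] mx].
    by rewrite porbit_id /= bE.
  by split=> // z z1 z2; apply: mx; rewrite z1.
have c_lt : c < s c.
  rewrite ltnNge; apply/negP => /(sb _ cb) cl.
  by move: cx xk; rewrite cl; lia.
have x_lt : x < s c.
  by rewrite ltnNge; apply/negP => /(cmax _ (sP _ cb)); lia.
have sc_l := le_l _ (sP _ cb).
have bc := cycle_minP _ _ bm _ cb.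
have scE : s c = (a c).+1 :> nat.
  by move: c_lt; rewrite verticesE; case: ifP.
have [xc|nxc] := eqVneq x c; first by rewrite xc; apply/andP; split; lia.
have [xc|nxac] := eqVneq x (a c).
  by rewrite xc aa; apply/andP; split; lia.
move: nxc nxac; rewrite -!val_eqE /= => nxc nxac.
have := IH c x; rewrite scE in x_lt c_lt sc_l.
by case/(_ _ _ _)/andP; lia.
Qed.

(** If [a k < a' k], count between [k] and [a k]: by nesting for [a] there are at most as many
    openers as closers, while by nesting for [a'] the closers, now with [a k] among them, have
    distinct partners among these openers. *)
Lemma planar_openers_le a a' k :
    a \in pairings m -> trisections a = finset.set0 ->
    a' \in pairings m -> trisections a' = finset.set0 ->
    openers a = openers a' -> k \in openers a ->
  a' k <= a k.
Proof.
move=> pa ta pa' ta' E kO; rewrite leqNgt; apply/negP => lt.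
have /pairingsP [aa na] := pa; have /pairingsP [aa' na'] := pa'.
have kl : k < a k by move: kO; rewrite inE.
pose I := [set x : 'I_m | (k < x) && (x < a k)].
have lO : a k \notin openers a by rewrite inE aa -leqNgt ltnW.
have le1 : #|I :&: openers a| <= #|I :\: openers a|.
  rewrite -(card_imset _ (@perm_inj _ a)); apply/subset_leq_card/fintype.subsetP => w.
  case/imsetP => x; rewrite !inE => /andP [/andP [kx xk] xO] ->.
  by rewrite (planar_nested pa ta kx xk) aa -leqNgt ltnW.
have le2 : #|a k |: (I :\: openers a)| <= #|I :&: openers a|.
  rewrite -(card_imset _ (@perm_inj _ a')); apply/subset_leq_card/fintype.subsetP => w.
  case/imsetP => x xI ->.
  have {xI} [kx xk xO] : [/\ k < x, x <= a k & x \notin openers a].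
    move: xI; rewrite finset.in_setU1 finset.in_setD => /orP [/eqP ->|/andP [xO]]; first by rewrite kl.
    by rewrite inE => /andP [kx /ltnW xk].
  have xO' : a' x < x.
    by move: xO; rewrite E inE -leqNgt leq_eqVlt val_eqE (negPf (na' x)).
  have /andP [lt1 lt2] := planar_nested pa' ta' kx (leq_ltn_trans xk lt).
  by rewrite finset.in_setI E !inE aa' lt1 xO' (leq_trans xO').
move: (leq_trans le2 le1); rewrite cardsU1.
have -> : (a k \in I :\: openers a) = false by rewrite !inE ltnn !andbF.
by rewrite add1n ltnn.
Qed.

Lemma planar_openers_inj a a' :
    a \in pairings m -> trisections a = finset.set0 ->
    a' \in pairings m -> trisections a' = finset.set0 ->
  openers a = openers a' -> a = a'.
Proof.
move=> pa ta pa' ta' E; have /pairingsP [aa na] := pa; have /pairingsP [aa' na'] := pa'.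
have eqO k : k \in openers a -> a k = a' k.
  move=> kO; apply: val_inj; apply/eqP; rewrite eqn_leq.
  by rewrite (planar_openers_le pa') 1?(planar_openers_le pa) -?E.
apply/permP => x; have [xO|xO] := boolP (x \in openers a); first exact: eqO.
have axO : a x \in openers a.
  by move: xO; rewrite !inE aa -leqNgt leq_eqVlt val_eqE (negPf (na x)).
by apply: (@perm_inj _ a'); rewrite aa' -[in LHS](eqO _ axO) aa.
Qed.

Lemma ballot_openers a : a \in pairings m ->
  ballot 0 [seq i \in openers a | i <- enum 'I_m].
Proof.
case/pairingsP => aa na; set t := map _ _.
have st : size t = m by rewrite size_map size_enum_ord.
(* The chords open before position [j]; their number is the height of the path there. *)
pose H j := [set k in openers a | (k < j) && (j <= a k)].
have main j : j <= m -> ballot #|H (m - j)| (drop (m - j) t).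
  elim: j => [|j IH] jm.
    rewrite subn0 drop_oversize ?st //= cards_eq0; apply/eqP/setP => k.
    by rewrite !inE (leqNgt m) (ltn_ord (a k)) !andbF.
  have lt : m - j.+1 < m by lia.
  pose i := Ordinal lt.
  have Ei : m - j = i.+1 by rewrite /=; lia.
  rewrite (drop_nth false) ?st // (_ : (m - j.+1).+1 = m - j); last lia.
  rewrite (nth_map i) ?size_enum_ord // (_ : nth i (enum 'I_m) (m - j.+1) = i); last first.
    exact: (nth_ord_enum i i).
  have := IH (ltnW jm); rewrite -[m - j.+1]/(i : nat) Ei.
  case: (boolP (i \in openers a)) => iO.
    have -> : H i.+1 = i |: H i.
      apply/setP => k; rewrite !inE -val_eqE /=.
      have := na k; have : i < a i by move: iO; rewrite inE.
      have [/val_inj ->|ne] := eqVneq (k : nat) i; first by rewrite ltnSn => ->.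
      have [E|ne'] := eqVneq (a k : nat) i.
        have <- : a k = i by apply: val_inj.
        by rewrite aa; lia.
      by move: ne' ne => /=; lia.
    by rewrite cardsU1 inE ltnn !andbF.
  have ai_lt : a i < i by move: iO; rewrite inE -leqNgt leq_eqVlt val_eqE (negPf (na i)).
  have -> : H i = a i |: H i.+1.
    apply/setP => k; rewrite !inE -val_eqE /=.
    have := na k.
    have [E|ne] := eqVneq (k : nat) (a i).
      have -> : k = a i by apply: val_inj.
      by rewrite aa /= ai_lt leqnn.
    have [E|ne'] := eqVneq (a k : nat) i.
      by case/eqP: ne; rewrite -(aa k); congr (nat_of_ord (a _)); apply: val_inj.
    have [E|ne2] := eqVneq (k : nat) i.
      have -> : k = i by apply: val_inj.
      by move: ai_lt => /=; lia.
    by move: ne' ne2 => /=; lia.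
  by rewrite cardsU1 !inE aa /= ltnn !andbF.
have := main m (leqnn m); rewrite subnn drop0.
by rewrite (_ : H 0 = finset.set0) ?cards0 //; apply/setP => k; rewrite !inE ltn0 andbF.
Qed.

End Planar.

Lemma card_layer0 p : 0 < p -> p.+1 * #|layer p 0| <= 'C(p.*2, p).
Proof.
move=> p0; rewrite -nb_ballot_catalan leq_pmul2l //.
pose f (a : {perm 'I_p.*2}) := [tuple (i \in openers a) | i < p.*2].
have lP a : a \in layer p 0 -> a \in pairings p.*2 /\ trisections a = finset.set0.
  move=> aL; split; first by move: aL; rewrite inE => /andP [].
  by apply/eqP; rewrite -cards_eq0 (layer_trisections p0 aL).
have f_inj : {in layer p 0 &, injective f}.
  move=> a a' /lP [pa ta] /lP [pa' ta'] E; apply: planar_openers_inj => //.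
  by apply/setP => i; have := congr1 (fun t => tnth t i) E; rewrite !tnth_mktuple.
rewrite -(card_in_imset f_inj); apply/subset_leq_card/fintype.subsetP => w /imsetP [a /lP [pa _] ->].
by rewrite inE; exact: ballot_openers.
Qed.

Local Open Scope ring_scope.

(** * The generating function of the genus *)

Section GenusSum.
Variables (R : realType) (p : nat).
Hypothesis p_gt0 : (0 < p)%N.

Lemma expR_ge_partial_sum (x : R) J : 0 <= x ->
  \sum_(j < J) x ^+ j / j`!%:R <= expR x.
Proof.
move=> x0; rewrite -(big_mkord xpredT (fun j => x ^+ j / j`!%:R)).
apply: (@nondecreasing_cvgn_le _ (series (exp_coeff x))).
  move=> i j ij; rewrite -subr_ge0 sub_series_geq //.
  by apply: sumr_ge0 => k _; rewrite exp_coeff_ge0.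
exact: is_cvg_series_exp_coeff.
Qed.

(** The factors of [layer_step] multiply up to [2 ^ j] times a factorial, so the layers are
    dominated by the terms of an exponential series. *)
Lemma card_layer_even j :
  (j`! * 2 ^ j * #|layer p j.*2| <= 'C(p.*2, 3) ^ j * #|layer p 0|)%N.
Proof.
elim: j => [|j IH]; first by rewrite !mul1n.
rewrite factS !expnS doubleS.
have := layer_step p_gt0 j.*2.
set A := #|layer p j.*2.+2|; set B := #|layer p j.*2| in IH * => H.
apply: (@leq_trans ('C(p.*2, 3) * (j`! * 2 ^ j * B))%N); last first.
  by rewrite -[leqRHS]mulnA leq_mul2l IH orbT.
have -> : (j.+1 * j`! * (2 * 2 ^ j) * A = j`! * 2 ^ j * (j.*2.+2 * A))%N.
  by rewrite -doubleS -mul2n; ring.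
have -> : ('C(p.*2, 3) * (j`! * 2 ^ j * B) = j`! * 2 ^ j * ('C(p.*2, 3) * B))%N by ring.
by rewrite leq_mul2l H orbT.
Qed.

Lemma card_layer_odd j : #|layer p j.*2.+1| = 0%N.
Proof.
elim: j => [|j IH]; first by rewrite layer1 // cards0.
by have := layer_step p_gt0 j.*2.+1; rewrite IH muln0 leqn0 muln_eq0 /= => /eqP.
Qed.

Lemma genus_sum_le (x : R) : 0 <= x ->
  \sum_(a in pairings p.*2) x ^+ (p.+1 - #|porbits (vertices a)|)
  <= #|layer p 0|%:R * expR ('C(p.*2, 3)%:R * x ^+ 2 / 2).
Proof.
move=> x0; set y := _ / 2.
have y0 : 0 <= y by rewrite /y; apply: divr_ge0 => //; apply: mulr_ge0 => //; exact: sqr_ge0.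
(* The range exceeds every possible exponent, and its even length allows the terms to be taken in
   pairs, the odd one of which vanishes. *)
have -> : \sum_(a in pairings p.*2) x ^+ (p.+1 - #|porbits (vertices a)|)
    = \sum_(t < p.+1.*2) #|layer p t|%:R * x ^+ t.
  pose g (a : {perm 'I_p.*2}) : 'I_p.+1.*2 := inord (p.+1 - #|porbits (vertices a)|).
  rewrite (partition_big g xpredT) //=; apply: eq_bigr => t _.
  rewrite -sum1_card natr_sum mulr_suml.
  have gE a : (p.+1 - #|porbits (vertices a)| < p.+1.*2)%N by lia.
  have inL a : (a \in pairings p.*2) && (g a == t) = (a \in layer p t).
    rewrite [RHS]inE; case pa: (a \in pairings _) => //=.
    rewrite -val_eqE /= inordK ?gE //.
    move: (card_trisections p_gt0 pa); move: #|porbits _| #|trisections a| => V W H.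
    by apply/eqP/eqP; lia.
  apply: eq_big => [a|a /andP [_ /eqP <-]]; first exact: inL.
  by rewrite mul1r inordK.
have le J : \sum_(t < J.*2) #|layer p t|%:R * x ^+ t
    <= #|layer p 0|%:R * \sum_(j < J) y ^+ j / j`!%:R.
  elim: J => [|J IH]; first by rewrite !big_ord0 mulr0.
  rewrite doubleS !big_ord_recr /= card_layer_odd mul0r addr0 mulrDr lerD //.
  rewrite mulrA ler_pdivlMr ?ltr0n ?fact_gt0 //.
  have := card_layer_even J; rewrite -(ler_nat R) !natrM !natrX => H.
  move: H; move: (#|layer p J.*2|) (#|layer p 0|) => A B H.
  have -> : x ^+ J.*2 = x ^+ 2 ^+ J by rewrite -exprM mul2n.
  rewrite /y; move: (x ^+ 2) (sqr_ge0 x) => X X0.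
  rewrite !exprMn exprVn [leRHS]mulrA ler_pdivlMr ?exprn_gt0 //.
  have -> : A%:R * X ^+ J * J`!%:R * 2 ^+ J = J`!%:R * 2 ^+ J * A%:R * X ^+ J by ring.
  rewrite [leRHS]mulrA (mulrC B%:R).
  by rewrite ler_wpM2r // exprn_ge0.
apply: le_trans (le _) _; apply: ler_wpM2l => //.
exact: expR_ge_partial_sum.
Qed.

End GenusSum.

(** * Labellings of the vertices *)

Lemma big_tuple_rcons (V : nmodType) (I : finType) m (F : seq I -> V) :
  \sum_(w : m.+1.-tuple I) F w = \sum_(w : m.-tuple I) \sum_(x : I) F (rcons w x).
Proof.
pose f (q : m.-tuple I * I) := [tuple of rcons q.1 q.2].
have f_inj : injective f.
  move=> [t b] [t' b'] /(congr1 val) /= /rcons_inj [E ->].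
  by congr pair; apply: val_inj.
have f_bij : bijective f.
  by apply: inj_card_bij => //; rewrite card_prod !card_tuple expnS mulnC.
rewrite (reindex f) /=; last exact: onW_bij.
by rewrite pair_big.
Qed.

(** The labels are summed out from the last to the first, since a weight depends only on its own
    label and on earlier ones. *)
Lemma sum_tuple_prod_le (R : realDomainType) (I : finType) (x0 : I) m
    (wt : nat -> seq I -> I -> R) (c : nat -> R) :
    (forall k s x, 0 <= wt k s x) -> (forall k, 0 <= c k) ->
    (forall k s, size s = k -> \sum_x wt k s x <= c k) ->
  \sum_(w : m.-tuple I) \prod_(k < m) wt k (take k w) (nth x0 w k)
  <= \prod_(k < m) c k.
Proof.
move=> wt0 c0 le; elim: m => [|m IH].
  rewrite big_ord0 (eq_bigr (fun=> 1)) => [|w _]; last by rewrite big_ord0.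
  by rewrite sumr_const card_tuple expn0.
rewrite (big_tuple_rcons m (fun w : seq I => \prod_(k < m.+1) wt k (take k w) (nth x0 w k))).
rewrite big_ord_recr /=.
apply: le_trans (ler_wpM2r (c0 m) IH); rewrite mulr_suml; apply: ler_sum => w _.
have -> : \sum_x \prod_(k < m.+1) wt k (take k (rcons w x)) (nth x0 (rcons w x) k)
  = (\prod_(k < m) wt k (take k w) (nth x0 w k)) * \sum_x wt m w x.
  rewrite mulr_sumr; apply: eq_bigr => x _; rewrite big_ord_recr /=; congr (_ * _).
    apply: eq_bigr => k _; have km : (k < size w)%N by rewrite size_tuple.
    by rewrite -cats1 takel_cat ?nth_cat ?km // ltnW.
  by rewrite -cats1 take_size_cat ?size_tuple // nth_cat size_tuple ltnn subnn.
by rewrite ler_wpM2l ?prodr_ge0 // le // size_tuple.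
Qed.

Section WalkSum.
Variables (R : realFieldType) (n p : nat) (b : 'I_n -> 'I_n -> R) (S2 T2 : R).
Hypothesis b_sym : forall i j, b i j = b j i.
Hypothesis S2P : forall i, \sum_j b i j ^+ 2 <= S2.
Hypothesis T2P : forall i j, b i j ^+ 2 <= T2.
Local Notation m := p.*2.
Variable a : {perm 'I_m}.
Hypothesis pa : a \in pairings m.
Hypothesis p_gt0 : (0 < p)%N.

(** [tnth w x] labels the corner where side [x] starts. Gluing [x] and [a x] in opposite directions
    identifies this corner with the end of side [a x], that is, with the start of side
    [vertices a x]. *)
Definition compatible (w : m.-tuple 'I_n) :=
  [forall x, tnth w (vertices a x) == tnth w x].

Let aa : involutive a. Proof. by case/pairingsP: pa. Qed.
Let na x : a x != x. Proof. by case/pairingsP: pa. Qed.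

Lemma compatibleP w : compatible w ->
  forall x y, y \in porbit (vertices a) x -> tnth w y = tnth w x.
Proof.
move=> /forallP cw x y /porbitP [i ->].
elim: i => [|i IH]; first by rewrite expg0 perm1.
by rewrite expgSr permM (eqP (cw _)).
Qed.

Lemma prod_compatible w : compatible w ->
  \prod_x b (tnth w x) (tnth w (cshift m x))
  = \prod_(x in openers a) b (tnth w x) (tnth w (cshift m x)) ^+ 2.
Proof.
move=> cw; rewrite (bigID (mem (openers a))) /=.
have -> : \prod_(x | x \notin openers a) b (tnth w x) (tnth w (cshift m x))
   = \prod_(x in openers a) b (tnth w x) (tnth w (cshift m x)).
  rewrite (reindex_inj (@perm_inj _ a)) /=; apply: eq_big => x.
    by rewrite !inE aa -leqNgt leq_eqVlt val_eqE eq_sym (negPf (na x)).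
  move=> _; move/forallP: cw => cw; rewrite b_sym.
  have := eqP (cw (a x)); rewrite /vertices !permM aa => ->.
  by have := eqP (cw x); rewrite /vertices permM => ->.
by rewrite -big_split /=; apply: eq_bigr => x _; rewrite expr2.
Qed.

(* The steps of the walk that discover a new vertex of the map. *)
Definition discoveries : {set 'I_m} :=
  [set x : 'I_m | (x.+1 < m)%N && (cshift m x \in cycle_minima (vertices a))].

Let shiftS (x : 'I_m) : (x.+1 < m)%N -> cshift m x = x.+1 :> nat.
Proof. by move=> lt; rewrite cshiftE ltn_eqF. Qed.

(** The corner [x + 1] is the image of [a x] under [vertices a]; if it is the least of its cycle,
    then [x + 1 <= a x]. *)
Lemma discoveries_openers : discoveries \subset openers a.
Proof.
apply/fintype.subsetP => x; rewrite !inE => /andP [lt].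
move=> /forall_inP /(_ (a x)); rewrite shiftS //; apply.
rewrite porbit_sym (_ : cshift m x = vertices a (a x)).
  exact: (mem_porbit _ 1).
by rewrite /vertices permM aa.
Qed.

(** The vertex of corner [0] is known at the start and is not discovered; the last side, which
    returns to it, is excluded. *)
Lemma card_discoveries : #|discoveries|.+1 = #|porbits (vertices a)|.
Proof.
have m0 : (0 < m)%N by lia.
rewrite -card_cycle_minima (cardsD1 (Ordinal m0) (cycle_minima _)).
have -> : Ordinal m0 \in cycle_minima (vertices a) by apply/cycle_minP.
rewrite add1n; congr _.+1; rewrite -(card_imset _ (@perm_inj _ (cshift m))).
apply: eq_card => y; rewrite !inE; apply/imsetP/andP => [[x]|[ny ym]].
  rewrite inE => /andP [lt xm] ->; split; last by move: xm; rewrite inE.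
  by rewrite -val_eqE /= shiftS.
exists ((cshift m)^-1%g y); rewrite ?permKV // inE permKV.
move: ym; rewrite [y \in _]inE => ->; rewrite andbT.
set x := (cshift m)^-1%g y; have := permKV (cshift m) y; rewrite -/x => E.
move: ny; rewrite -val_eqE -E /= cshiftE; case: ifP => // /eqP ne _.
by have := ltn_ord x; lia.
Qed.

(** Labels are chosen along the tour. Corner [0] has [n] choices, a discovered corner is summed
    against the [b ^ 2] of the side that leads to it, and any other label is forced by the least
    corner of its vertex. *)
Lemma sum_discoveries :
  \sum_(w | compatible w)
     \prod_(x in discoveries) b (tnth w x) (tnth w (cshift m x)) ^+ 2
  <= n%:R * S2 ^+ #|discoveries|.
Proof.
have S20 : (0 < n)%N -> 0 <= S2.
  by case: n b S2P => // n' b' /(_ ord0) H _; apply: le_trans H; apply: sumr_ge0 => i _; exact: sqr_ge0.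
have m0 : (0 < m)%N by lia.
have [n0|n0] := posnP n.
  rewrite big1 => [|w _]; first by have -> : n%:R = 0 :> R; rewrite ?n0 ?mul0r.
  by case: (tnth w (Ordinal m0)) => i; rewrite {1}n0.
pose x0 := Ordinal n0.
pose D' := [set cshift m x | x in discoveries].
have D'P (k : 'I_m) : reflect (exists2 x, x \in discoveries & k = x.+1 :> nat) (k \in D').
  apply: (iffP imsetP) => [[x xD ->]|[x xD E]]; exists x => //.
    by rewrite shiftS //; move: xD; rewrite inE => /andP [].
  by apply: val_inj; rewrite /= shiftS //; move: xD; rewrite inE => /andP [].
pose i0 := Ordinal m0.
have D'min (k : 'I_m) : k != i0 -> k \notin D' -> k \notin cycle_minima (vertices a).
  move=> k0; apply: contra => km; apply/imsetP; exists ((cshift m)^-1%g k); last by rewrite permKV.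
  rewrite inE permKV km andbT; set x := (cshift m)^-1%g k.
  have := permKV (cshift m) k; rewrite -/x => E.
  move: k0; rewrite -val_eqE -E /= cshiftE; case: ifP => // /eqP ne _.
  by have := ltn_ord x; lia.
have D'0 : i0 \notin D' by apply/D'P => -[x _].
(* Weights are indexed by all of [nat]; the default [i0] is taken only from [m] on. *)
pose ord k := insubd i0 k.
pose r k : nat := s2val (ex_cycle_min (vertices a) (ord k)).
pose wt k (s : seq 'I_n) (x : 'I_n) : R :=
  if k == 0%N then 1 else
  if ord k \in D' then b (nth x0 s k.-1) x ^+ 2 else (x == nth x0 s (r k))%:R.
pose c k : R := if k == 0%N then n%:R else if ord k \in D' then S2 else 1.
have wt0 k s x : 0 <= wt k s x.
  by rewrite /wt; do 2?case: ifP => _ //; rewrite ?sqr_ge0.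
have c0 k : 0 <= c k by rewrite /c; do 2?case: ifP => _ //; exact: S20.
have le k s : size s = k -> \sum_x wt k s x <= c k.
  move=> _; rewrite /wt /c; case: ifP => _.
    by rewrite sumr_const card_ord.
  case: ifP => _; first exact: S2P.
  rewrite (bigD1 (nth x0 s (r k))) //= eqxx big1 ?addr0 // => x ne.
  by rewrite (negPf ne).
have ordE (k : 'I_m) : ord k = k by rewrite /ord valKd.
have cardD' : #|D'| = #|discoveries| by rewrite card_imset //; exact: perm_inj.
have split_prod (F G : 'I_m -> R) :
    (forall k, k \notin D' -> k != i0 -> F k = 1) ->
    (forall k, k \in D' -> F k = G k) ->
    \prod_k F k = F i0 * \prod_(k in D') G k.
  move=> F1 FG; rewrite (bigD1 i0) //=; congr (_ * _).
  rewrite (bigID (mem D')) /= mulrC big1 => [|k /andP [k0 kD]]; last exact: F1.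
  rewrite mul1r; apply: eq_big => k.
    by case: eqP => //= ->; rewrite (negPf D'0).
  by case/andP => _; exact: FG.
have := sum_tuple_prod_le x0 m wt0 c0 le.
have -> : \prod_(k < m) c k = n%:R * S2 ^+ #|discoveries|.
  rewrite (split_prod _ (fun=> S2)).
  - by rewrite prodr_const cardD'.
  - move=> k kD k0; rewrite /c ordE (negPf kD).
    by case: eqP => // E; case/eqP: k0; apply: val_inj.
  - move=> k kD; rewrite /c ordE kD; case: eqP => // E.
    by case/negP: D'0; rewrite (_ : i0 = k) //; apply: val_inj.
(* The incompatible labellings have nonnegative weight and are dropped. *)
apply: le_trans; rewrite [leRHS](bigID compatible) /=.
rewrite -[leLHS]addr0 lerD //; last first.
  by apply: sumr_ge0 => w _; apply: prodr_ge0 => k _.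
apply: ler_sum => w cw; rewrite le_eqVlt; apply/orP; left; apply/eqP.
rewrite (split_prod _ (fun k : 'I_m => b (nth x0 w k.-1) (nth x0 w k) ^+ 2)).
- rewrite {1}/wt eqxx mul1r big_imset /=; last by move=> x y _ _; exact: perm_inj.
  apply: eq_bigr => x; rewrite inE => /andP [lt _].
  by rewrite !(tnth_nth x0) shiftS.
- move=> k kD k0; rewrite /wt ordE (negPf kD); case: ifP => // _.
  rewrite /r ordE; case: ex_cycle_min => y /= yk ym.
  have lt : (y < k)%N.
    have := cycle_minP _ _ ym k; rewrite porbit_sym => /(_ yk).
    rewrite leq_eqVlt => /orP [/eqP /val_inj E|//].
    by case/negP: (D'min _ k0 kD); rewrite -E.
  by rewrite nth_take // -!tnth_nth (compatibleP cw yk) eqxx.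
- move=> k kD; rewrite /wt ordE kD.
  case: eqP => [E|/eqP k0].
    by case/negP: D'0; rewrite (_ : i0 = k) //; apply: val_inj.
  by rewrite nth_take //; lia.
Qed.

Lemma walk_sum_le : 0 <= T2 ->
  \sum_(w | compatible w) \prod_x b (tnth w x) (tnth w (cshift m x))
  <= n%:R * S2 ^+ (#|porbits (vertices a)|.-1)
     * T2 ^+ (p.+1 - #|porbits (vertices a)|).
Proof.
move=> T20; have cD := card_discoveries.
have -> : #|porbits (vertices a)|.-1 = #|discoveries| by rewrite -cD.
have -> : (p.+1 - #|porbits (vertices a)|)%N = #|openers a :\: discoveries|.
  rewrite cardsD (finset.setIidPr discoveries_openers) (card_openers pa) -cD.
  by rewrite subSS.
apply: le_trans (ler_wpM2r _ sum_discoveries); last by rewrite exprn_ge0.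
rewrite mulr_suml; apply: ler_sum => w cw; rewrite (prod_compatible cw).
rewrite (big_setID discoveries) /= (finset.setIidPr discoveries_openers).
rewrite ler_wpM2l //; first by apply: prodr_ge0 => x _; exact: sqr_ge0.
rewrite -prodr_const; apply: ler_prod => x _.
by rewrite sqr_ge0 T2P.
Qed.

End WalkSum.

(** * Wick's formula *)

(** The moments of the centered Gaussian law of variance [v], given by the recursion of integration
    by parts; over a general ring, so that it makes sense both in [R] and in [R[i]]. *)
Fixpoint gaussian_moment (R : pzRingType) (v : R) (k : nat) : R :=
  match k with
  | 0 => 1
  | 1 => 0
  | (k'.+1 as k1).+1 => k1%:R * v * gaussian_moment v k'
  end.

Lemma gaussian_momentS (R : comRingType) (v : R) k :
  gaussian_moment v k.+1 = k%:R * v * gaussian_moment v k.-1.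
Proof. by case: k => [|k]; rewrite //= !mul0r. Qed.

Section Wick.
Variables (C : comRingType) (I : finType) (v : I -> C).

Definition monomial_moment (u : seq I) : C :=
  \prod_i gaussian_moment (v i) (count_mem i u).

Definition seq_del (A : Type) j (u : seq A) := take j u ++ drop j.+1 u.

(** Gaussian integration by parts: the first letter is paired with each of its other occurrences. *)
Lemma monomial_moment_cons i u (i0 : I) :
  monomial_moment (i :: u)
  = \sum_(j < size u) (nth i0 u j == i)%:R * v i * monomial_moment (seq_del j u).
Proof.
have step j : (j < size u)%N -> nth i0 u j = i ->
    monomial_moment (seq_del j u)
    = gaussian_moment (v i) (count_mem i u).-1
      * \prod_(k | k != i) gaussian_moment (v k) (count_mem k u).
  move=> ju ui; have cE k : count_mem k (seq_del j u) = (count_mem k u - (k == i))%N.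
    rewrite -{2}(cat_take_drop j u) (drop_nth i0) // ui !count_cat /= eq_sym.
    by lia.
  rewrite /monomial_moment (bigD1 i) //= cE eqxx subn1; congr (_ * _).
  by apply: eq_bigr => k /negPf ki; rewrite cE ki subn0.
rewrite (eq_bigr (fun j : 'I_(size u) => (nth i0 u j == i)%:R * (v i *
   (gaussian_moment (v i) (count_mem i u).-1
      * \prod_(k | k != i) gaussian_moment (v k) (count_mem k u))))); last first.
  move=> j _; case: eqP => [E|_]; last by rewrite !mul0r.
  by rewrite mulrA -(step j).
rewrite -mulr_suml -natr_sum.
have -> : (\sum_(j < size u) (nth i0 u j == i) = count_mem i u)%N.
  rewrite -sum1_count [RHS](big_nth i0) big_mkord [RHS]big_mkcond /=.
  by apply: eq_bigr => j _; case: eqP.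
rewrite /monomial_moment (bigD1 i) //= eqxx add1n gaussian_momentS !mulrA.
by congr (_ * _); apply: eq_bigr => k /negPf; rewrite eq_sym => ->.
Qed.

Variables (A : Type) (l : A -> I -> C).

(* Multilinear extension of [phi] to products of the linear forms [l x]. *)
Fixpoint multilin (phi : seq I -> C) (s : seq A) : C :=
  match s with
  | [::] => phi [::]
  | x :: s' => \sum_i l x i * multilin (fun u => phi (i :: u)) s'
  end.

Lemma eq_multilin phi psi s : (forall u, size u = size s -> phi u = psi u) ->
  multilin phi s = multilin psi s.
Proof.
elim: s phi psi => [|x s IH] phi psi E /=; first exact: E.
by apply: eq_bigr => i _; congr (_ * _); apply: IH => u su; apply: E; rewrite /= su.
Qed.

Lemma multilin_sum (J : finType) (phi : J -> seq I -> C) s :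
  multilin (fun u => \sum_j phi j u) s = \sum_j multilin (phi j) s.
Proof.
elim: s phi => [|x s IH] phi //=; rewrite exchange_big /=.
by apply: eq_bigr => i _; rewrite IH mulr_sumr.
Qed.

Lemma multilinZ c phi s : multilin (fun u => c * phi u) s = c * multilin phi s.
Proof.
elim: s phi => [|x s IH] phi //=; rewrite mulr_sumr.
by apply: eq_bigr => i _; rewrite IH mulrCA.
Qed.

Lemma multilin_del (i0 i : I) (x0 : A) phi s j : (j < size s)%N ->
  multilin (fun u => (nth i0 u j == i)%:R * phi (seq_del j u)) s
  = l (nth x0 s j) i * multilin phi (seq_del j s).
Proof.
elim: s phi j => [|x s IH] phi [|j] //= js.
  rewrite /seq_del /= drop0 (bigD1 i) //= eqxx big1 ?addr0 => [|k ki].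
    by congr (_ * _); apply: eq_multilin => u _; rewrite mul1r drop0.
  rewrite (@eq_multilin _ (fun u => 0 * phi u)) ?multilinZ ?mul0r ?mulr0 //.
  by move=> u _; rewrite (negPf ki) !mul0r.
rewrite mulr_sumr; apply: eq_bigr => k _.
by rewrite [RHS]mulrCA -(IH (fun u => phi (k :: u))).
Qed.

Definition cov x y : C := \sum_i v i * l x i * l y i.

(** Integration by parts, extended multilinearly from the independent variables to linear forms in
    them. [cov] involves no conjugation, as the trace is a polynomial in the entries. *)
Lemma wick_cons (x0 x : A) s :
  multilin monomial_moment (x :: s)
  = \sum_(j < size s) cov x (nth x0 s j) * multilin monomial_moment (seq_del j s).
Proof.
have [i0 _|I0] := pickP (mem I); last first.
  rewrite /= big1; last by move=> i; have := I0 i.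
  by rewrite big1 // => j _; rewrite /cov big1 ?mul0r // => i; have := I0 i.
rewrite /=; under eq_bigr => i _.
  rewrite (eq_multilin (psi := fun u => \sum_(j < size s) v i *
      ((nth i0 u j == i)%:R * monomial_moment (seq_del j u)))); last first.
    move=> u su; rewrite (monomial_moment_cons _ _ i0) su.
    by apply: eq_bigr => j _; rewrite mulrCA mulrA.
  rewrite multilin_sum mulr_sumr; under eq_bigr => j _ do
    rewrite multilinZ (multilin_del _ _ x0) //.
over.
rewrite exchange_big /=; apply: eq_bigr => j _; rewrite /cov mulr_suml.
by apply: eq_bigr => i _; rewrite !mulrA [l x i * v i]mulrC.
Qed.

End Wick.

(** * Wick's formula as a bound by a number of matchings *)

Section WickBound.
Variables (C : numFieldType) (I : finType) (v : I -> C) (m : nat).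
Variables (l : 'I_m -> I -> C) (K : rel 'I_m) (beta : 'I_m -> C).
Hypothesis K_sym : symmetric K.
Hypothesis beta_ge0 : forall x, 0 <= beta x.
Hypothesis covE : forall x y, cov v l x y = (K x y)%:R * beta x * beta y.
Implicit Types (a : {perm 'I_m}) (B : {set 'I_m}).

(** Matchings of [B] along [K] are permutations of the whole type that fix the complement of [B], so
    that removing a pair does not change the type. *)
Definition matchings B : {set {perm 'I_m}} :=
  [set a : {perm 'I_m} | [forall x, (a (a x) == x) &&
     (if x \in B then (a x != x) && K x (a x) else a x == x)]].

Lemma matchingsP B a : reflect (forall x, a (a x) = x /\
    if x \in B then a x != x /\ K x (a x) else a x = x) (a \in matchings B).
Proof.
rewrite inE; apply: (iffP forallP) => H x; have := H x.
  by case/andP => /eqP ->; case: ifP => _; [case/andP | move/eqP].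
case=> -> H2; rewrite eqxx /=; move: H2; case: ifP => _; first by case=> -> ->.
by move/eqP.
Qed.

(** The pair [x], [y] is added by a product with [tperm x y]; the partner of [x] tells apart the
    images for different [y]. *)
Lemma card_matchings_ge B x : x \notin B ->
  (\sum_(y in B) K x y * #|matchings (B :\ y)| <= #|matchings (x |: B)|)%N.
Proof.
move=> xB.
have part : (\sum_(y in B) #|[set a in matchings (x |: B) | a x == y]| <= #|matchings (x |: B)|)%N.
  rewrite -[leqRHS]sum1_card (partition_big (fun a => a x) xpredT) //=.
  rewrite [leqRHS](bigID (mem B)) /= (leq_trans _ (leq_addr _ _)) //.
  by apply: leq_sum => y _; rewrite sum1dep_card.
apply: leq_trans part; apply: leq_sum => y yB.
case Kxy: (K x y); last by rewrite mul0n.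
have nxy : x != y by apply: contraNneq xB => ->.
rewrite mul1n -(card_imset _ (mulgI (tperm x y))).
apply/subset_leq_card/fintype.subsetP => w /imsetP [a aM ->].
have /matchingsP H := aM.
have ax : a x = x by have [_] := H x; rewrite !inE (negPf xB) andbF.
have ay : a y = y by have [_] := H y; rewrite !inE eqxx.
rewrite inE permM tpermL ay eqxx andbT; apply/matchingsP => z; rewrite !permM.
have [->|nzx] := eqVneq z x.
  by rewrite tpermL ay tpermR ax !inE eqxx /= eq_sym.
have [->|nzy] := eqVneq z y.
  by rewrite tpermR ax tpermL ay !inE yB orbT K_sym.
rewrite (tpermD (z := z)) 1?eq_sym //.
have [aaz Hz] := H z.
have nax : a z != x by rewrite -ax (inj_eq perm_inj).
have nay : a z != y by rewrite -ay (inj_eq perm_inj).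
rewrite tpermD 1?eq_sym //; split=> //.
by move: Hz; rewrite !inE (negPf nzx) nzy.
Qed.

Lemma wick_le (s : seq 'I_m) : uniq s ->
  multilin l (monomial_moment v) s
  <= #|matchings [set x in s]|%:R * \prod_(x <- s) beta x.
Proof.
have [n] := ubnP (size s); elim: n s => // n IH [|x s] /=.
  move=> _ _; rewrite big_nil mulr1 /monomial_moment big1 // ler1n.
  apply/card_gt0P; exists 1%g; apply/matchingsP => x.
  by rewrite !perm1 inE.
rewrite ltnS => lt /andP [xs us].
rewrite -[X in X <= _]/(multilin l (monomial_moment v) (x :: s)) (wick_cons _ _ x).
have delE j : (j < size s)%N -> seq_del j s = rem (nth x s j) s.
  by move=> js; rewrite remE index_uniq.
rewrite (eq_bigr (fun j : 'I_(size s) => cov v l x (nth x s j) *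
  multilin l (monomial_moment v) (rem (nth x s j) s))); last first.
  by move=> j _; rewrite delE.
rewrite -(big_mkord xpredT (fun j => cov v l x (nth x s j) *
  multilin l (monomial_moment v) (rem (nth x s j) s))).
rewrite -(big_nth x xpredT (fun y => cov v l x y * multilin l (monomial_moment v) (rem y s))).
have xB : x \notin [set y in s] by rewrite inE.
have -> : [set y in x :: s] = x |: [set y in s] by apply/setP => y; rewrite !inE.
have := card_matchings_ge xB; rewrite -(ler_nat C) => H.
have b0 : 0 <= \prod_(y <- x :: s) beta y by rewrite prodr_ge0.
apply: le_trans (ler_wpM2r b0 H).
rewrite natr_sum mulr_suml big_uniq //=.
rewrite (eq_bigl (mem s)) => [|y]; last by [].
rewrite [leRHS](eq_bigl (mem s)) => [|y]; last by rewrite inE.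
apply: ler_sum => y ys.
have -> : \prod_(z <- x :: s) beta z = beta x * beta y * \prod_(z <- rem y s) beta z.
  by rewrite big_cons (perm_big _ (perm_to_rem ys)) big_cons mulrA.
rewrite covE natrM -!mulrA; apply: ler_wpM2l => //.
rewrite [_%:R * _]mulrCA; apply: ler_wpM2l => //.
rewrite [_%:R * _]mulrCA; apply: ler_wpM2l => //.
have -> : [set z in s] :\ y = [set z in rem y s].
  by apply/setP => z; rewrite !inE mem_rem_uniq.
apply: IH; last exact: rem_uniq.
by rewrite size_rem //; case: s ys lt {xs us delE xB H b0} => //= *; lia.
Qed.

End WickBound.

Local Open Scope classical_set_scope.
Local Open Scope ring_scope.

(** * Products of independent variables *)

Import numFieldNormedType.Exports HBNNSimple.

Section Density.
Local Open Scope ereal_scope.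
Context d1 d2 (T : measurableType d1) (S : measurableType d2) (R : realType).
Variables (mu : {measure set T -> \bar R}) (Y : T -> S) (h : T -> R).
Hypotheses (mY : measurable_fun setT Y) (mh : measurable_fun setT h).
Hypothesis h_ge0 : forall w, (0 <= h w)%R.

Lemma integral_density_nnsfun (g : {nnsfun S >-> R}) :
  \int[mu]_w (h w * g (Y w))%:E =
  \sum_(k \in range g) k%:E * \int[mu]_w (h w * \1_(g @^-1` [set k]) (Y w))%:E.
Proof.
have mgk k : measurable_fun setT (fun w => h w * (k * \1_(g @^-1` [set k]) (Y w)))%R.
  apply: measurable_funM => //; apply: measurable_funM => //.
  exact: measurableT_comp.
under [LHS]eq_integral do rewrite fimfunE fsbig_finite//= mulr_sumr -sumEFin.
rewrite fsbig_finite //= ge0_integral_sum //; last 2 first.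
- by move=> k; exact/measurable_EFinP.
- move=> k w _; rewrite lee_fin; apply: mulr_ge0 => //.
  rewrite indicE; case: (boolP (_ \in _)) => [|_]; last by rewrite mulr0.
  by rewrite inE /= => <-; rewrite mulr1.
apply: eq_bigr => k _.
have [k0|k0] := ltP k 0%R.
  rewrite preimage_nnfun0 // !integral0_eq ?mule0 // => w _.
    by rewrite indic0 mulr0.
  by rewrite indic0 !mulr0.
under eq_integral do rewrite mulrCA EFinM.
rewrite ge0_integralZl //=.
- by apply/measurable_EFinP/measurable_funM => //; exact: measurableT_comp.
- by move=> w _; rewrite lee_fin mulr_ge0.
Qed.

Lemma integral_density_lim (f : S -> R) (mf : measurable_fun setT (EFin \o f)) :
    (forall x, (0 <= f x)%R) ->
  \int[mu]_w (h w * f (Y w))%:E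
  = limn (fun n => \int[mu]_w (h w * nnsfun_approx measurableT mf n (Y w))%:E).
Proof.
move=> f0; rewrite -monotone_convergence//=.
- apply: eq_integral => w _; apply/esym/cvg_lim => //.
  rewrite EFinM; under eq_fun do rewrite EFinM.
  apply: cvgeZl => //; apply: cvg_nnsfun_approx => // t _; exact: f0.
- move=> n; apply/measurable_EFinP/measurable_funM => //.
  exact: measurableT_comp.
- by move=> n w _; rewrite lee_fin mulr_ge0.
- move=> w _ a b ab; rewrite lee_fin; apply: ler_wpM2l => //.
  exact/lefP/nd_nnsfun_approx.
Qed.

End Density.

(** Two weighted maps that push forward to the same measure on [S]. Change of law, Gaussian density,
    reflection and independence are all instances. *)
Lemma eq_integral_density d1 d2 d (T1 : measurableType d1) (T2 : measurableType d2)
    (S : measurableType d) (R : realType)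
    (mu1 : {measure set T1 -> \bar R}) (mu2 : {measure set T2 -> \bar R})
    (Y1 : T1 -> S) (Y2 : T2 -> S) (h1 : T1 -> R) (h2 : T2 -> R) (f : S -> R) :
    measurable_fun setT Y1 -> measurable_fun setT h1 -> (forall w, 0 <= h1 w) ->
    measurable_fun setT Y2 -> measurable_fun setT h2 -> (forall w, 0 <= h2 w) ->
    (forall A, measurable A ->
      (\int[mu1]_w (h1 w * \1_A (Y1 w))%:E
       = \int[mu2]_w (h2 w * \1_A (Y2 w))%:E)%E) ->
    measurable_fun setT f -> (forall x, 0 <= f x) ->
  (\int[mu1]_w (h1 w * f (Y1 w))%:E = \int[mu2]_w (h2 w * f (Y2 w))%:E)%E.
Proof.
move=> mY1 mh1 h10 mY2 mh2 h20 E mf f0.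
have mf' : measurable_fun setT (EFin \o f) by exact/measurable_EFinP.
rewrite !(integral_density_lim _ _ _ _ mf') //; congr (limn _).
apply/funext => n; rewrite !integral_density_nnsfun //.
apply: eq_fsbigr => k _; rewrite E //.
Qed.

Section IndependentProducts.
Context d (T : measurableType d) (R : realType) (P : probability T R).
Variables (I : finType) (Y : I -> T -> measurableTypeR R).
Hypothesis mY : forall i, measurable_fun setT (Y i).
Hypothesis indepY : forall B : I -> set (measurableTypeR R),
  (forall i, measurable (B i)) ->
  P (\bigcap_i (Y i @^-1` B i)) = (\prod_i P (Y i @^-1` B i))%E.

Lemma integral_indep_prod_ge0 (F : I -> measurableTypeR R -> R) (e : I -> R) :
    (forall i, measurable_fun setT (F i)) -> (forall i x, 0 <= F i x) ->
    (forall i, \int[P]_w (F i (Y i w))%:E = (e i)%:E)%E ->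
  (\int[P]_w (\prod_i F i (Y i w))%:E = (\prod_i e i)%:E)%E.
Proof.
move=> mF F0 eE.
(* [s] lists the factors that need not be indicators. One factor at a time is replaced by an
   indicator, the product of the others serving as a density; with indicators alone the claim is
   independence. *)
suff H (s : seq I) : (forall i, i \notin s -> exists2 B, measurable B & F i = \1_B) ->
    (\int[P]_w (\prod_i F i (Y i w))%:E = (\prod_i e i)%:E)%E.
  by apply: (H (enum I)) => i; rewrite mem_enum.
elim: s F e mF F0 eE => [|j s IH] F e mF F0 eE FB.
  have /choice [B BP] : forall i, exists B, measurable B /\ F i = \1_B.
    by move=> i; have [B mB FE] := FB i isT; exists B.
  have mYB i : measurable (Y i @^-1` B i).
    by rewrite -[X in measurable X]setTI; apply: mY => //; case: (BP i).
  have eP i : P (Y i @^-1` B i) = (e i)%:E.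
    rewrite -eE; have [_ ->] := BP i.
    rewrite -[in LHS](setIT (_ @^-1` _)) -integral_indic //.
  have mB i : measurable (B i) by have [] := BP i.
  rewrite -prodEFin; under [RHS]eq_bigr do rewrite -eP.
  rewrite -indepY // -[in RHS](setIT (\bigcap_i _)) -integral_indic //; last first.
    by apply: fin_bigcap_measurable.
  apply: eq_integral => w _; congr (_%:E); rewrite indicE.
  case: (boolP (w \in _)) => [|/negP]; rewrite inE => H.
    rewrite big1 // => i _; have [_ ->] := BP i.
    by rewrite indicE mem_set //; exact: H.
  have [i Hi] : exists i, ~ B i (Y i w).
    by apply/existsNP => H'; apply: H => i _; exact: H'.
  rewrite (bigD1 i) //=; have [_ ->] := BP i.
  by rewrite indicE memNset // mul0r.
have e0 i : 0 <= e i by rewrite -lee_fin -eE; apply: integral_ge0 => w _; rewrite lee_fin.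
pose h w := \prod_(i | i != j) F i (Y i w).
pose c := \prod_(i | i != j) e i.
have mh : measurable_fun setT h.
  rewrite /h; under eq_fun do rewrite big_mkcond.
  apply: measurable_prod => i _; case: (i != j); last exact: measurable_cst.
  exact: measurableT_comp.
have h0 w : 0 <= h w by apply: prodr_ge0.
have c0 : 0 <= c by apply: prodr_ge0.
under eq_integral do rewrite (bigD1 j) //= mulrC -/(h _).
rewrite (eq_integral_density (Y2 := Y j) (h2 := cst c) (mu2 := P)) //.
- transitivity (\int[P]_w (c%:E * (F j (Y j w))%:E))%E; first exact: eq_integral.
  rewrite ge0_integralZl //= ?eE.
  + by rewrite (bigD1 j) //= mulrC EFinM.
  + by apply/measurable_EFinP; exact: measurableT_comp.
  + by move=> w _; rewrite lee_fin.
move=> A mA.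
have mYA : measurable (Y j @^-1` A).
  by rewrite -[X in measurable X]setTI; apply: mY.
pose F' i : measurableTypeR R -> R := if i == j then \1_A else F i.
pose e' i := if i == j then fine (P (Y j @^-1` A)) else e i.
have PA : (\int[P]_w (\1_A (Y j w))%:E)%E = P (Y j @^-1` A).
  by rewrite -[in RHS](setIT (_ @^-1` _)) -integral_indic.
have -> : (\int[P]_w (h w * \1_A (Y j w))%:E = \int[P]_w (\prod_i F' i (Y i w))%:E)%E.
  apply: eq_integral => w _; rewrite [in RHS](bigD1 j) //= /F' eqxx mulrC.
  by congr ((_ * _)%:E); apply: eq_bigr => i /negPf ->.
rewrite (IH F' e').
- transitivity (\int[P]_w (c%:E * (\1_A (Y j w))%:E))%E; last exact: eq_integral.
  rewrite ge0_integralZl //=; last by apply/measurable_EFinP; exact: measurableT_comp.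
  rewrite PA -(fineK (fin_num_measure P _ mYA)) -EFinM (bigD1 j) //= {1}/e' eqxx mulrC.
  by congr ((_ * _)%:E); apply: eq_bigr => i /negPf; rewrite /e' => ->.
- by move=> i; rewrite /F'; case: ifP.
- by move=> i x; rewrite /F'; case: ifP => // _; rewrite indicE.
- move=> i; rewrite /F' /e'; case: eqP => [->|//].
  by rewrite PA fineK // fin_num_measure.
- move=> i is'; rewrite /F'; case: eqP => [_|/eqP ij]; first by exists A.
  by apply: FB; rewrite inE negb_or ij.
Qed.

Lemma integral_indep_prod (F : I -> measurableTypeR R -> R) (e : I -> R) :
    (forall i, measurable_fun setT (F i)) ->
    (forall i, P.-integrable setT (EFin \o (F i \o Y i))) ->
    (forall i, \int[P]_w (F i (Y i w))%:E = (e i)%:E)%E ->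
  P.-integrable setT (EFin \o (fun w => \prod_i F i (Y i w)))
  /\ (\int[P]_w (\prod_i F i (Y i w))%:E = (\prod_i e i)%:E)%E.
Proof.
move=> mF iF eE.
(* [s] lists the factors that may change sign; each in turn is split into its positive and negative
   parts. *)
suff H (s : seq I) : (forall i, i \notin s -> forall x, 0 <= F i x) ->
    P.-integrable setT (EFin \o (fun w => \prod_i F i (Y i w)))
    /\ (\int[P]_w (\prod_i F i (Y i w))%:E = (\prod_i e i)%:E)%E.
  by apply: (H (enum I)) => i; rewrite mem_enum.
elim: s F e mF iF eE => [|j s IH] F e mF iF eE F0.
  have E := integral_indep_prod_ge0 mF (fun i => F0 i isT) eE.
  split=> //; apply/integrableP; split.
    apply/measurable_EFinP; apply: measurable_prod => i _.
    exact: measurableT_comp.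
  rewrite (eq_integral (fun w => (\prod_i F i (Y i w))%:E)); first by rewrite E ltry.
  by move=> w _ /=; rewrite ger0_norm // prodr_ge0 // => i _; exact: F0.
pose Fs (g : (R -> R) -> R -> R) i : measurableTypeR R -> R :=
  if i == j then g (F j) else F i.
pose es g i := if i == j then fine (\int[P]_w (g (F j) (Y j w))%:E)%E else e i.
have step (g : (R -> R) -> R -> R) : (forall x, 0 <= g (F j) x) ->
    measurable_fun setT (g (F j) : measurableTypeR R -> R) ->
    P.-integrable setT (EFin \o (g (F j) \o Y j)) ->
    P.-integrable setT (EFin \o (fun w => \prod_i Fs g i (Y i w)))
    /\ (\int[P]_w (\prod_i Fs g i (Y i w))%:E = (\prod_i es g i)%:E)%E.
  move=> g0 mg ig; apply: IH => i; rewrite /Fs /es.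
  - by case: ifP.
  - by case: eqP => [->|_].
  - by case: eqP => [->|_]; rewrite ?fineK //; apply: integrable_fin_num.
  - move=> is' x; case: eqP => [//|/eqP ij].
    by apply: F0; rewrite inE negb_or ij.
have iFj : P.-integrable setT (EFin \o (F j \o Y j)) := iF j.
have [ip Ep] := step (@funrpos R R) (funrpos_ge0 _) (measurable_funrpos (mF j)) (integrable_funrpos measurableT iFj).
have [im Em] := step (@funrneg R R) (funrneg_ge0 _) (measurable_funrneg (mF j)) (integrable_funrneg measurableT iFj).
have posneg (f : R -> R) x : f x = (@funrpos R R) f x - (@funrneg R R) f x.
  by rewrite -[in LHS](funrposBneg f).
have split_prod (u : (R -> R) -> R -> R) w :
    \prod_i Fs u i (Y i w) = u (F j) (Y j w) * \prod_(i | i != j) F i (Y i w).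
  rewrite (bigD1 j) //= {1}/Fs eqxx; congr (_ * _).
  by apply: eq_bigr => i /negPf ij; rewrite /Fs ij.
have prodE : (fun w => \prod_i F i (Y i w))
    = (fun w => \prod_i Fs (@funrpos R R) i (Y i w) - \prod_i Fs (@funrneg R R) i (Y i w)).
  apply/funext => w; rewrite !split_prod -mulrBl (bigD1 j) //=; congr (_ * _).
  exact: posneg.
have ejE : e j = es (@funrpos R R) j - es (@funrneg R R) j.
  apply: EFin_inj; rewrite -eE /es eqxx EFinB.
  rewrite !fineK; last 2 first.
  - exact: (integrable_fin_num measurableT (integrable_funrneg measurableT iFj)).
  - exact: (integrable_fin_num measurableT (integrable_funrpos measurableT iFj)).
  rewrite -(integralB measurableT (integrable_funrpos measurableT iFj) (integrable_funrneg measurableT iFj)).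
  by apply: eq_integral => w _; rewrite /= -EFinB; congr (_%:E); exact: posneg.
rewrite prodE; split.
  have -> : EFin \o (fun w => \prod_i Fs (@funrpos R R) i (Y i w) - \prod_i Fs (@funrneg R R) i (Y i w))
    = ((EFin \o (fun w => \prod_i Fs (@funrpos R R) i (Y i w))%R)
      \- (EFin \o (fun w => \prod_i Fs (@funrneg R R) i (Y i w))%R))%E by apply/funext => w /=; rewrite EFinB.
  exact: integrableB.
have esE u : \prod_i es u i = es u j * \prod_(i | i != j) e i.
  rewrite (bigD1 j) //=; congr (_ * _).
  by apply: eq_bigr => i /negPf ij; rewrite /es ij.
transitivity (\int[P]_w ((EFin \o (fun w => \prod_i Fs (@funrpos R R) i (Y i w))%R)
      \- (EFin \o (fun w => \prod_i Fs (@funrneg R R) i (Y i w))%R)) w)%E.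
  by apply: eq_integral => w _ /=; rewrite -EFinB; congr (_%:E); have := congr1 (fun f => f w) prodE.
rewrite (integralB measurableT ip im) /= Ep Em -EFinB !esE -mulrBl -ejE.
by rewrite [in RHS](bigD1 j).
Qed.

End IndependentProducts.

(** * Moments of Gaussian laws *)

Section NormalMoments.
Context (R : realType) (s : R) (s_gt0 : 0 < s).
Local Notation mu := (@lebesgue_measure R).
Local Notation phi := (normal_pdf 0 s).

Let s0 : s != 0. Proof. by rewrite gt_eqF. Qed.

Let phiE x : phi x = normal_peak s * expR (- (x ^+ 2 / (s ^+ 2 *+ 2))).
Proof. by rewrite /normal_pdf (negPf s0) /normal_fun subr0 mulNr. Qed.

Let phiN x : phi (- x) = phi x.
Proof. by rewrite !phiE sqrrN. Qed.

Let phi_ge0 x : 0 <= phi x. Proof. exact: normal_pdf_ge0. Qed.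

Let mphi : measurable_fun setT phi. Proof. exact: measurable_normal_pdf. Qed.

Let cphi : continuous phi. Proof. exact: continuous_normal_pdf. Qed.

Lemma is_derive_normal_pdf (x : R) :
  is_derive x (1 : R) phi (- (x / s ^+ 2) * phi x).
Proof.
have -> : phi = (fun y => normal_peak s * expR (- (y ^+ 2 / (s ^+ 2 *+ 2)))).
  by apply/funext => y; exact: phiE.
apply: is_derive_eq; rewrite /GRing.scale /=.
by field.
Qed.

Lemma integral_lebesgueN (f : R -> R) : measurable_fun setT f -> (forall x, 0 <= f x) ->
  (\int[mu]_x (f (- x))%:E = \int[mu]_x (f x)%:E)%E.
Proof.
move=> mf f0.
transitivity (\int[mu]_x (cst 1 x * f (- x))%:E)%E.
  by apply: eq_integral => x _; rewrite /= mul1r.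
rewrite (eq_integral_density (S := measurableTypeR R) (Y2 := idfun) (h2 := cst 1) (mu2 := mu)) //.
- by apply: eq_integral => x _; rewrite /= mul1r.
- exact: measurable_id.
- move=> A mA; have mNA : measurable ((-%R : R -> R) @^-1` A).
  by rewrite -[X in measurable X]setTI; exact: oppr_measurable.
transitivity (mu ((-%R : R -> R) @^-1` A)).
  rewrite -[in RHS](setIT (_ @^-1` _)) -integral_indic //.
  by apply: eq_integral => x _; rewrite /= mul1r.
rewrite -[RHS]/(\int[mu]_w (1 * \1_A w)%:E)%E.
under [RHS]eq_integral do rewrite mul1r.
by rewrite integral_indic // setIT; exact: lebesgue_measureN.
Qed.

(** On the half line the integrand is nonnegative for every [k], so the recursion can be proved in
    the extended reals before the moments are known to be finite. *)
Let M k : \bar R := (\int[mu]_(x in `[0%R, +oo[) (x ^+ k * phi x)%:E)%E.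

Let mM (D : set R) k : measurable_fun D (fun x : R => x ^+ k * phi x).
Proof.
by apply: measurable_funTS; apply: measurable_funM => //; exact: measurable_funX.
Qed.

Lemma normal_pdf_by_parts (k n : nat) :
  (\int[mu]_(x in `[0%R, n.+1%:R]) (x ^+ k.+2 * phi x)%:E
   = (k.+1%:R * s ^+ 2)%:E * \int[mu]_(x in `[0%R, n.+1%:R]) (x ^+ k * phi x)%:E
     - (s ^+ 2 * (n.+1%:R ^+ k.+1 * phi n.+1%:R))%:E)%E.
Proof.
have cont (F f : R -> R) : (forall x, is_derive x (1 : R) F (f x)) -> continuous F.
  by move=> dF x; apply: differentiable_continuous; apply/derivable1_diffP; have [] := dF x.
have lr (F f : R -> R) a b : (forall x, is_derive x (1 : R) F (f x)) ->
    derivable_oo_LRcontinuous F a b /\ derive1 F = f.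
  move=> dF; split; last by apply/funext => x; rewrite derive1E; have [] := dF x.
  split=> [x _||]; first by have [] := dF x.
    by apply: cvg_at_right_filter; exact: (cont _ _ dF).
  by apply: cvg_at_left_filter; exact: (cont _ _ dF).
pose F := fun x : R => x ^+ k.+1.
pose f := fun x : R => k.+1%:R * x ^+ k.
pose G := fun x : R => - s ^+ 2 * phi x.
pose g := fun x : R => x * phi x.
have dF x : is_derive x (1 : R) F (f x).
  have -> : F = (@id R) ^+ k.+1 by rewrite exprfctE.
  apply: is_derive_eq; rewrite /GRing.scale /= /f; ring.
have dG x : is_derive x (1 : R) G (g x).
  have := is_derive_normal_pdf x => ?.
  by rewrite /G; apply: is_derive_eq; rewrite /GRing.scale /= /g; field.
have [lF FE] := lr _ _ 0 n.+1%:R dF.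
have [lG GE] := lr _ _ 0 n.+1%:R dG.
have cf : continuous f.
  by move=> x; apply: cvgMr; apply: exprn_continuous.
have cg : continuous g.
  by move=> x; apply: cvgM; [exact: cvg_id | exact: cphi].
have := @integration_by_parts R F G f g 0 n.+1%:R (ltr0Sn _ _)
  (continuous_subspaceT cf) lF (fun x _ => congr1 (fun u => u x) FE)
  (continuous_subspaceT cg) lG (fun x _ => congr1 (fun u => u x) GE).
rewrite /F /G /f /g expr0n /= mul0r subr0 => E.
transitivity (\int[mu]_(x in `[0%R, n.+1%:R]) (x ^+ k.+1 * (x * phi x))%:E)%E.
  by apply: eq_integral => x _; rewrite mulrA -exprSr.
rewrite E addeC; congr (_ + _)%E.
  transitivity (- \int[mu]_(x in `[0%R, n.+1%:R]) ((- (k.+1%:R * s ^+ 2))%:E * (x ^+ k * phi x)%:E))%E.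
    by congr (- _)%E; apply: eq_integral => x _; rewrite -EFinM; congr (_%:E); ring.
  rewrite integralZl //; first by rewrite EFinN mulNe oppeK.
  apply: continuous_compact_integrable; first exact: segment_compact.
  apply: continuous_subspaceT => x; apply: cvgM; last exact: cphi.
  exact: exprn_continuous.
by congr (_%:E); ring.
Qed.

(** The boundary term of the integration by parts. With [u := n + 1], the bound
    [exp y >= y ^ (k + 1) / (k + 1)!] at [y := u ^ 2 / v2] makes it at most [c / u ^ (k + 1)]. *)
Lemma normal_pdf_decay k :
  (fun n : nat => n.+1%:R ^+ k.+1 * phi n.+1%:R) @ \oo --> (0 : R).
Proof.
set v2 := s ^+ 2 *+ 2; have v20 : 0 < v2 by rewrite pmulrn_lgt0 ?exprn_gt0.
pose c := normal_peak s * (k.+1`!%:R * v2 ^+ k.+1).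
have c0 : 0 <= c.
  by rewrite /c !mulr_ge0 ?normal_peak_ge0 // exprn_ge0 // ltW.
apply: (@squeeze_cvgr _ _ _ _ (cst 0) (fun n => c * harmonic n)).
- near=> n; apply/andP; split.
    by rewrite mulr_ge0 ?exprn_ge0.
  rewrite /= phiE /c mulrCA -mulrA ler_wpM2l ?normal_peak_ge0 // expRN.
  set u := n.+1%:R; have u0 : 0 < u :> R by rewrite ltr0n.
  have y0 : 0 <= u ^+ 2 / v2 by rewrite divr_ge0 ?sqr_ge0 // ltW.
  have := expR_ge1Dxn k y0; set y := u ^+ 2 / v2 => Ey.
  have yk0 : 0 < y ^+ k.+1 / k.+1`!%:R.
    by rewrite divr_gt0 ?exprn_gt0 ?divr_gt0 ?exprn_gt0 // ltr0n fact_gt0.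
  have le : (expR y)^-1 <= (y ^+ k.+1 / k.+1`!%:R)^-1.
    by rewrite lef_pV2 ?posrE ?expR_gt0 //; apply: le_trans Ey; rewrite lerDr.
  apply: le_trans (ler_wpM2l (exprn_ge0 _ (ltW u0)) le) _.
  have -> : u ^+ k.+1 * (y ^+ k.+1 / k.+1`!%:R)^-1
      = k.+1`!%:R * v2 ^+ k.+1 * (u ^+ k.+1)^-1.
    rewrite /y expr_div_n -exprM mulnC exprM expr2; field.
    by rewrite !expf_neq0 ?gt_eqF // ltr0n fact_gt0.
  apply: ler_wpM2l; first by rewrite mulr_ge0 // exprn_ge0 // ltW.
  rewrite /harmonic /= lef_pV2 ?posrE ?exprn_gt0 // exprS ler_peMr ?(ltW u0) //.
  by rewrite exprn_ege1 // ler1n.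
- exact: cvg_cst.
- rewrite -[X in _ --> X](mulr0 c); apply: cvgMr; exact: cvg_harmonic.
Unshelve. all: by end_near. Qed.

Let cvg_M k : (\int[mu]_(x in `[0%R, n.+1%:R]) (x ^+ k * phi x)%:E)%E @[n --> \oo] --> M k.
Proof.
(* The truncation makes the integrand nonnegative on the whole line without changing it on the half
   line. *)
pose f (x : R) := Num.max 0 x ^+ k * phi x.
have mf : measurable_fun setT f.
  apply: measurable_funM => //; apply: measurable_funX.
  exact: measurable_maxr.
have f0 x : 0 <= f x by rewrite mulr_ge0 ?exprn_ge0 // le_max lexx.
have E (D : set R) : D `<=` `[0%R, +oo[ ->
    (\int[mu]_(x in D) (x ^+ k * phi x)%:E = \int[mu]_(x in D) (f x)%:E)%E.
  move=> D0; apply: eq_integral => x /set_mem /D0; rewrite /= in_itv /= andbT => x0.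
  by rewrite /f max_r.
have := ge0_cvgn_integral (mu := mu) f0 mf; rewrite -cvg_shiftS -E // -/(M k).
apply: cvg_trans; apply: near_eq_cvg; near=> n.
by rewrite /= E //; exact: subset_itvl.
Unshelve. all: by end_near. Qed.

Lemma half_moment_rec k : (M k.+2 = (k.+1%:R * s ^+ 2)%:E * M k)%E.
Proof.
have H1 := @cvg_M k.+2.
have H2 : ((k.+1%:R * s ^+ 2)%:E * \int[mu]_(x in `[0%R, n.+1%:R]) (x ^+ k * phi x)%:E
     - (s ^+ 2 * (n.+1%:R ^+ k.+1 * phi n.+1%:R))%:E)%E @[n --> \oo]
    --> ((k.+1%:R * s ^+ 2)%:E * M k - 0%:E)%E.
  apply: cvgeB.
  - by rewrite fin_num_adde_defl.
  - by apply: cvgeZl => //; exact: cvg_M.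
  - apply: cvg_EFin; first by near=> n.
    rewrite -[X in _ --> X](mulr0 (s ^+ 2)); apply: cvgMr; exact: normal_pdf_decay.
move: H1; under eq_fun do rewrite normal_pdf_by_parts.
move=> H1.
rewrite -[RHS]sube0; exact: (cvg_unique _ H1 H2).
Unshelve. all: by end_near. Qed.

Lemma integral_normal_prob_ge0 (f : R -> R) :
    measurable_fun setT f -> (forall x, 0 <= f x) ->
  (\int[normal_prob 0 s]_x (f x)%:E = \int[mu]_x (phi x * f x)%:E)%E.
Proof.
move=> mf f0; transitivity (\int[normal_prob 0 s]_x (cst 1 x * f (idfun x))%:E)%E.
  by apply: eq_integral => x _; rewrite /= mul1r.
rewrite (eq_integral_density (S := measurableTypeR R) (Y2 := idfun) (h2 := phi) (mu2 := mu)) //; do ?exact: measurable_id.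
move=> A mA; transitivity (normal_prob 0 s A).
  rewrite -[in RHS](setIT A) -integral_indic //.
  by apply: eq_integral => x _; rewrite /= mul1r.
rewrite /normal_prob [LHS]integral_mkcond; apply: eq_integral => x _.
rewrite patchE /= indicE; case: (x \in A); first by rewrite mulr1.
by rewrite mulr0.
Qed.

Lemma normal_prob_symmetric (f : R -> R) :
    measurable_fun setT f -> (forall x, 0 <= f x) ->
  (\int[normal_prob 0 s]_x (f (- x))%:E = \int[normal_prob 0 s]_x (f x)%:E)%E.
Proof.
move=> mf f0; rewrite !integral_normal_prob_ge0 //; last first.
  by apply: measurableT_comp => //; exact: oppr_measurable.
rewrite -[RHS]integral_lebesgueN; last 2 first.
- exact: measurable_funM.
- by move=> x; rewrite mulr_ge0.
by apply: eq_integral => x _; rewrite phiN.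
Qed.

Let normal_absX k :
  (\int[normal_prob 0 s]_x (`|x| ^+ k)%:E = 2%:E * M k)%E.
Proof.
rewrite integral_normal_prob_ge0 => [|//|x]; last 2 first.
- by apply: measurable_funX; exact: normr_measurable.
- by rewrite exprn_ge0.
rewrite ge0_symfun_integralT => [|x|x|x].
- congr (_ * _)%E; rewrite /M -set_itvcy; apply: eq_integral => x.
  by rewrite inE /= in_itv /= andbT => x0; rewrite ger0_norm // mulrC.
- by rewrite mulr_ge0 ?exprn_ge0.
- apply: cvgM; first exact: cphi.
  apply: (cvg_comp _ (fun y => y ^+ k)); first exact: (@norm_continuous _ R^o).
  exact: exprn_continuous.
- by rewrite /= phiN normrN.
Qed.

Let M0 : (2%:E * M 0 = 1)%E.
Proof.
rewrite -normal_absX; under eq_integral do rewrite expr0.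
rewrite integral_cst // mul1e; exact: probability_setT.
Qed.

Lemma normal_prob_even_moment j :
  (\int[normal_prob 0 s]_x (x ^+ j.*2)%:E = (gaussian_moment (s ^+ 2) j.*2)%:E)%E.
Proof.
transitivity (2%:E * M j.*2)%E.
  rewrite -normal_absX; apply: eq_integral => x _.
  by rewrite -[in RHS]mul2n exprM real_normK ?num_real // -exprM mul2n.
elim: j => [|j IH]; first by rewrite M0.
rewrite doubleS half_moment_rec muleCA IH -EFinM gaussian_momentS.
by congr (_%:E).
Qed.

(** Even moments are finite by the recursion, odd ones because
    [x ^ (2j + 1) <= x ^ (2j) + x ^ (2j + 2)]. *)
Let M_lty k : (M k < +oo)%E.
Proof.
have even j : (M j.*2 < +oo)%E.
  elim: j => [|j IH].
    rewrite ltey; apply/eqP => E; have := M0.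
    by rewrite -[0.*2]/0%N in E *; rewrite E gt0_muley ?lte_fin.
  rewrite doubleS half_moment_rec lte_mul_pinfty //.
  by rewrite lee_fin mulr_ge0 ?sqr_ge0.
rewrite -(odd_double_half k); case: (odd k) => //=; last exact: even.
set j := k./2; rewrite add1n.
apply: (@le_lt_trans _ _ (M j.*2 + M j.+1.*2)%E); last by rewrite lte_add_pinfty.
rewrite /M -ge0_integralD //; last 4 first.
- by move=> x; rewrite /= in_itv /= andbT => x0; rewrite lee_fin mulr_ge0 ?exprn_ge0.
- by apply/measurable_EFinP; exact: mM.
- by move=> x; rewrite /= in_itv /= andbT => x0; rewrite lee_fin mulr_ge0 ?exprn_ge0.
- by apply/measurable_EFinP; exact: mM.
apply: ge0_le_integral => //.
- by move=> x; rewrite /= in_itv /= andbT => x0; rewrite lee_fin mulr_ge0 ?exprn_ge0.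
- by apply/measurable_EFinP; exact: mM.
- by apply: emeasurable_funD; apply/measurable_EFinP; exact: mM.
move=> x; rewrite /= in_itv /= andbT => x0; rewrite -EFinD lee_fin -mulrDl.
rewrite ler_wpM2r // doubleS !exprS.
have y0 : 0 <= x ^+ j.*2 by rewrite exprn_ge0.
have h : 0 <= 1 - x + x * x by nra.
by have := mulr_ge0 y0 h; lra.
Qed.

Lemma normal_prob_abs_moment_lty k :
  (\int[normal_prob 0 s]_x (`|x| ^+ k)%:E < +oo)%E.
Proof. by rewrite normal_absX lte_mul_pinfty ?lee_fin. Qed.

End NormalMoments.

Section NormalRMoments.
Context (R : realType) (v : R) (v_ge0 : 0 <= v).

Lemma normalR_even_moment j :
  (\int[normalR v]_x (x ^+ j.*2)%:E = (gaussian_moment v j.*2)%:E)%E.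
Proof.
rewrite /normalR; case: eqP => [->|/eqP v0].
  rewrite integral_dirac //; last first.
    by apply/measurable_EFinP; exact: measurable_funX.
  rewrite diracT mul1e; congr (_%:E).
  by case: j => [|j] //; rewrite doubleS /= mulr0 mul0r expr0n.
have sv : 0 < Num.sqrt v by rewrite sqrtr_gt0 lt_neqAle eq_sym v0.
by rewrite normal_prob_even_moment // sqr_sqrtr.
Qed.

Lemma normalR_abs_moment_lty k : (\int[normalR v]_x (`|x| ^+ k)%:E < +oo)%E.
Proof.
rewrite /normalR; case: eqP => [_|/eqP v0].
  rewrite integral_dirac //; last first.
    by apply/measurable_EFinP/measurable_funX; exact: normr_measurable.
  by rewrite diracT mul1e ltry.
apply: normal_prob_abs_moment_lty.
by rewrite sqrtr_gt0 lt_neqAle eq_sym v0.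
Qed.

Lemma normalR_symmetric (f : R -> R) :
    measurable_fun setT f -> (forall x, 0 <= f x) ->
  (\int[normalR v]_x (f (- x))%:E = \int[normalR v]_x (f x)%:E)%E.
Proof.
move=> mf f0; rewrite /normalR; case: eqP => [_|/eqP v0].
  have mfN : measurable_fun setT (fun x : R => f (- x)).
    by apply: measurableT_comp => //; exact: oppr_measurable.
  by rewrite !integral_dirac ?oppr0 //; exact/measurable_EFinP.
apply: normal_prob_symmetric => //.
by rewrite sqrtr_gt0 lt_neqAle eq_sym v0.
Qed.

Context d (T : measurableType d) (P : probability T R) (Y : T -> measurableTypeR R).
Hypothesis lawY : has_law P Y (normalR v).

Lemma integral_has_law (f : R -> R) :
    measurable_fun setT f -> (forall x, 0 <= f x) ->
  (\int[P]_w (f (Y w))%:E = \int[normalR v]_x (f x)%:E)%E.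
Proof.
have [mY PY] := lawY; move=> mf f0.
transitivity (\int[P]_w (cst 1 w * f (Y w))%:E)%E.
  by apply: eq_integral => x _; rewrite /= mul1r.
transitivity (\int[normalR v]_x (cst 1 x * f (idfun x))%:E)%E; last first.
  by apply: eq_integral => x _; rewrite /= mul1r.
apply: (eq_integral_density (S := measurableTypeR R)) => //; do ?exact: measurable_id.
move=> A mA; have mYA : measurable (Y @^-1` A).
  by rewrite -[X in measurable X]setTI; exact: mY.
transitivity (P (Y @^-1` A)).
  rewrite -[in RHS](setIT (_ @^-1` _)) -integral_indic //.
  by apply: eq_integral => x _; rewrite /= mul1r.
rewrite PY // -[in LHS](setIT A) -integral_indic //.
by apply: eq_integral => x _; rewrite /= mul1r.
Qed.

(** For odd [k] the positive and negative parts have the same integral by symmetry of the law,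
    finite by integrability, and they cancel. *)
Lemma has_law_moment k :
  P.-integrable setT (EFin \o (fun w => Y w ^+ k)) /\
  (\int[P]_w (Y w ^+ k)%:E = (gaussian_moment v k)%:E)%E.
Proof.
have [mY _] := lawY; have mX : measurable_fun setT (fun x : R => x ^+ k).
  exact: measurable_funX.
have iX : P.-integrable setT (EFin \o (fun w => Y w ^+ k)).
  apply/integrableP; split; first by apply/measurable_EFinP; exact: measurable_funX.
  rewrite (eq_integral (fun w => (`|Y w| ^+ k)%:E)) => [|w _]; last by rewrite /= normrX.
  rewrite (integral_has_law (f := fun x => `|x| ^+ k)) ?normalR_abs_moment_lty //.
  by apply: measurable_funX; exact: normr_measurable.
split=> //.
case: (boolP (odd k)) => ok; last first.
  have Ek : k = k./2.*2 by rewrite -[LHS]odd_double_half (negPf ok).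
  rewrite Ek (@integral_has_law (fun x => x ^+ k./2.*2)) ?normalR_even_moment //.
  by move=> x; rewrite -mul2n exprM exprn_ge0 // sqr_ge0.
rewrite integralE.
have max_ge0 (g : R -> R) x : 0 <= Num.max (g x) 0 by rewrite le_max lexx orbT.
have mp : measurable_fun setT (fun x : R => Num.max (x ^+ k) 0) by exact: measurable_maxr.
have mn : measurable_fun setT (fun x : R => Num.max (- (x ^+ k)) 0).
  by apply: measurable_maxr => //; apply: measurableT_comp => //; exact: oppr_measurable.
have -> : (\int[P]_w ((fun w => (Y w ^+ k)%:E)^\- w) =
           \int[P]_w ((fun w => (Y w ^+ k)%:E)^\+ w))%E.
  transitivity (\int[normalR v]_x (Num.max (- (x ^+ k)) 0)%:E)%E.
    rewrite -(integral_has_law mn (max_ge0 _)).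
    by apply: eq_integral => w _; rewrite funenegE EFin_max.
  transitivity (\int[normalR v]_x (Num.max (x ^+ k) 0)%:E)%E.
    rewrite -(normalR_symmetric mp (max_ge0 _)).
    apply: eq_integral => x _; congr (Num.max _ _)%:E.
    by rewrite exprNn -signr_odd ok expr1 mulN1r.
  rewrite -(integral_has_law mp (max_ge0 _)).
  by apply: eq_integral => w _; rewrite funeposE EFin_max.
rewrite subee; last first.
  exact: (integrable_fin_num measurableT (integrable_funepos measurableT iX)).
congr (_%:E).
have [n] := ubnP k; elim: n k ok {mX iX mp mn} => // n IH [|[|k]] // ok lt.
rewrite gaussian_momentS /= -IH ?mulr0 //; last by lia.
by move: ok; rewrite /= negbK.
Qed.

End NormalRMoments.

(** * Complex expectations and Gaussian linear forms *)

Section ComplexExpectation.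
Local Open Scope complex_scope.
Local Open Scope ring_scope.
Context d (T : measurableType d) (R : realType) (P : probability T R).

(** A relation rather than a function, so that integrability is carried along with the value. *)
Definition has_expectation (f : T -> R[i]) (z : R[i]) : Prop :=
  [/\ P.-integrable setT (EFin \o (fun w => complex.Re (f w))),
      P.-integrable setT (EFin \o (fun w => complex.Im (f w))),
      (\int[P]_w (complex.Re (f w))%:E = (complex.Re z)%:E)%E
    & (\int[P]_w (complex.Im (f w))%:E = (complex.Im z)%:E)%E].

Lemma has_expectation_real (f : T -> R) (r : R) :
  P.-integrable setT (EFin \o f) -> (\int[P]_w (f w)%:E = r%:E)%E ->
  has_expectation (fun w => (f w)%:C) r%:C.
Proof.
move=> fi fr; split=> //=.
  by apply: (eq_integrable measurableT (cst 0%E)) => //; exact: integrable0.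
by rewrite integral0.
Qed.

Lemma has_expectation_lin (f g : T -> R[i]) (a y z : R[i]) :
  has_expectation f y -> has_expectation g z ->
  has_expectation (fun w => a * f w + g w) (a * y + z).
Proof.
case=> fR fI fRy fIy [gR gI gRz gIz].
have comb (r1 r2 : R) (p q h : T -> R) (x1 x2 x3 : R) :
    P.-integrable setT (EFin \o p) -> P.-integrable setT (EFin \o q) ->
    P.-integrable setT (EFin \o h) ->
    (\int[P]_w (p w)%:E = x1%:E)%E -> (\int[P]_w (q w)%:E = x2%:E)%E ->
    (\int[P]_w (h w)%:E = x3%:E)%E ->
    P.-integrable setT (EFin \o (fun w => r1 * p w + r2 * q w + h w)) /\
    (\int[P]_w (r1 * p w + r2 * q w + h w)%:E = (r1 * x1 + r2 * x2 + x3)%:E)%E.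
  move=> ip iq ih E1 E2 E3.
  have i1 := integrableZl measurableT r1 ip.
  have i2 := integrableZl measurableT r2 iq.
  have i12 := integrableD measurableT i1 i2.
  have i123 := integrableD measurableT i12 ih.
  split; first exact: i123.
  transitivity (\int[P]_w ((r1%:E * (p w)%:E + r2%:E * (q w)%:E) + (h w)%:E))%E.
    exact: eq_integral.
  rewrite (integralD measurableT i12 ih) (integralD measurableT i1 i2).
  by rewrite !integralZl // E1 E2 E3.
have [H1 H2] := comb (complex.Re a) (- complex.Im a) _ _ _ _ _ _ fR fI gR fRy fIy gRz.
have [H3 H4] := comb (complex.Im a) (complex.Re a) _ _ _ _ _ _ fR fI gI fRy fIy gIz.
have ReE (u x t : R[i]) : complex.Re (u * x + t) =
    complex.Re u * complex.Re x + - complex.Im u * complex.Im x + complex.Re t.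
  by case: u x t => [? ?] [? ?] [? ?] /=; rewrite mulNr.
have ImE (u x t : R[i]) : complex.Im (u * x + t) =
    complex.Im u * complex.Re x + complex.Re u * complex.Im x + complex.Im t.
  by case: u x t => [? ?] [? ?] [? ?] /=; ring.
split; first by under eq_fun do rewrite ReE.
- by under eq_fun do rewrite ImE.
- by under eq_integral do rewrite ReE; rewrite ReE.
- by under eq_integral do rewrite ImE; rewrite ImE.
Qed.

Lemma has_expectation_sum (I : Type) (r : seq I) (f : I -> T -> R[i]) (z : I -> R[i]) :
  (forall i, has_expectation (f i) (z i)) ->
  has_expectation (fun w => \sum_(i <- r) f i w) (\sum_(i <- r) z i).
Proof.
move=> H; elim: r => [|i r IH].
  under eq_fun do rewrite big_nil; rewrite big_nil.
  have := @has_expectation_real (cst 0) 0; apply; first exact: integrable0.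
  exact: integral0.
under eq_fun do rewrite big_cons; rewrite big_cons.
have := has_expectation_lin 1 (H i) IH.
by under eq_fun do rewrite mul1r; rewrite mul1r.
Qed.

Lemma has_expectationZ a (f : T -> R[i]) z :
  has_expectation f z -> has_expectation (fun w => a * f w) (a * z).
Proof.
move=> H; have H0 : has_expectation (fun=> 0) 0.
  by apply: (@has_expectation_real (cst 0) 0); [exact: integrable0 | exact: integral0].
have := has_expectation_lin a H H0; rewrite addr0.
by have -> : (fun w => a * f w + 0) = (fun w => a * f w) by apply/funext => w; rewrite addr0.
Qed.

Section GaussianFamily.
Variables (I : finType) (G : I -> T -> measurableTypeR R) (v : I -> R).
Hypothesis v_ge0 : forall i, 0 <= v i.
Hypothesis lawG : forall i, has_law P (G i) (normalR (v i)).
Hypothesis indepG : forall B : I -> set (measurableTypeR R),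
  (forall i, measurable (B i)) ->
  P (\bigcap_i (G i @^-1` B i)) = (\prod_i P (G i @^-1` B i))%E.

Lemma prod_seq_count (u : seq I) (g : I -> R) :
  \prod_(i <- u) g i = \prod_i g i ^+ count_mem i u.
Proof.
elim: u => [|j u IH].
  by rewrite big_nil big1 // => i _; rewrite expr0.
rewrite big_cons IH (bigD1 j) //= [in RHS](bigD1 j) //= eqxx add1n exprS mulrA.
by congr (_ * _); apply: eq_bigr => i /negPf; rewrite eq_sym => ->.
Qed.

Lemma gaussian_monomial (u : seq I) :
  P.-integrable setT (EFin \o (fun w => \prod_(i <- u) G i w)) /\
  (\int[P]_w (\prod_(i <- u) G i w)%:E = (monomial_moment v u)%:E)%E.
Proof.
have mG i : measurable_fun setT (G i) by have [] := lawG i.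
have [] := @integral_indep_prod _ _ _ P I G mG indepG
   (fun i x => x ^+ count_mem i u) (fun i => gaussian_moment (v i) (count_mem i u)).
- by move=> i; exact: measurable_funX.
- by move=> i; have [] := has_law_moment (v_ge0 i) (lawG i) (count_mem i u).
- by move=> i; have [] := has_law_moment (v_ge0 i) (lawG i) (count_mem i u).
move=> H1 H2; split; first by under eq_fun do rewrite prod_seq_count.
by under eq_integral do rewrite prod_seq_count.
Qed.

Lemma gaussian_moment_rmorph (x : R) k :
  (gaussian_moment x k)%:C = gaussian_moment x%:C k.
Proof.
have [n] := ubnP k; elim: n k => // n IH [|[|k]] //= lt.
by rewrite rmorphM rmorphM /= IH ?rmorph_nat //; lia.
Qed.

Lemma monomial_moment_rmorph (u : seq I) :
  (monomial_moment v u)%:C = monomial_moment (fun i => (v i)%:C) u.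
Proof.
by rewrite /monomial_moment rmorph_prod; apply: eq_bigr => i _; exact: gaussian_moment_rmorph.
Qed.

Lemma wick_expectation (A : Type) (l : A -> I -> R[i]) (s : seq A) :
  has_expectation (fun w => \prod_(x <- s) \sum_i l x i * (G i w)%:C)
    (multilin l (monomial_moment (fun i => (v i)%:C)) s).
Proof.
(* [u] collects the variables picked from the forms already expanded. *)
suff H u : has_expectation
    (fun w => (\prod_(i <- u) G i w)%:C * \prod_(x <- s) \sum_i l x i * (G i w)%:C)
    (multilin l (fun u' => monomial_moment (fun i => (v i)%:C) (u ++ u')) s).
  have := H [::]; by under eq_fun do rewrite big_nil mul1r.
elim: s u => [|x s IH] u /=.
  under eq_fun do rewrite big_nil mulr1; rewrite cats0 -monomial_moment_rmorph.
  have [H1 H2] := gaussian_monomial u; exact: has_expectation_real.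
have -> : (fun w => (\prod_(i <- u) G i w)%:C *
      \prod_(y <- x :: s) \sum_i l y i * (G i w)%:C)
    = (fun w => \sum_i l x i * ((\prod_(j <- rcons u i) G j w)%:C *
        \prod_(y <- s) \sum_i l y i * (G i w)%:C)).
  apply/funext => w; rewrite big_cons mulrA mulr_sumr mulr_suml.
  apply: eq_bigr => i _; rewrite -cats1 big_cat big_seq1 /= rmorphM /=.
  by rewrite mulrCA !mulrA.
apply: has_expectation_sum => i; apply: has_expectationZ.
rewrite (@eq_multilin _ _ _ _ _ (fun u' => monomial_moment (fun i => (v i)%:C) (rcons u i ++ u'))) //.
by move=> u' _; rewrite cat_rcons.
Qed.

End GaussianFamily.

End ComplexExpectation.

(** * Moments of the random matrix *)

Section TraceWalks.
Variables (C : comNzRingType) (n : nat) (A : 'M[C]_n).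

Lemma expmx_walks m i j :
  (A ^+ m.+1) i j = \sum_(w : m.-tuple 'I_n)
    \prod_(k < m.+1) A (nth i (i :: rcons w j) k) (nth i (rcons w j) k).
Proof.
elim: m j => [|m IH] j.
  rewrite expr1 (eq_bigr (fun=> A i j)) => [|w _]; last first.
    by rewrite big_ord_recl big_ord0 mulr1 tuple0.
  by rewrite sumr_const card_tuple.
rewrite exprSr mxE (big_tuple_rcons m (fun w : seq 'I_n =>
  \prod_(k < m.+2) A (nth i (i :: rcons w j) k) (nth i (rcons w j) k))).
rewrite exchange_big /=; apply: eq_bigr => l _; rewrite IH mulr_suml.
apply: eq_bigr => w _; rewrite [RHS]big_ord_recr /=; congr (_ * _).
  apply: eq_bigr => k _; congr (A _ _).
    by rewrite -[in RHS]rcons_cons [RHS]nth_rcons /= size_rcons size_tuple (ltn_trans (ltn_ord k)) //.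
  by rewrite [RHS]nth_rcons size_rcons size_tuple (ltn_ord k).
by rewrite !nth_rcons !size_rcons size_tuple ltnSn !ltnn !eqxx.
Qed.

Lemma mxtrace_walks m : (0 < m)%N -> \tr (A ^+ m) =
  \sum_(w : m.-tuple 'I_n) \prod_x A (tnth w x) (tnth w (cshift m x)).
Proof.
case: m => // m _; rewrite /mxtrace.
pose F (w : seq 'I_n) := if w is i :: _ then
  \prod_(k < m.+1) A (nth i w k) (nth i w (if k.+1 == m.+1 then 0 else k.+1)) else 0.
transitivity (\sum_(w : m.+1.-tuple 'I_n) F w); last first.
  apply: eq_bigr => w _; case/tupleP: w => i w; apply: eq_bigr => k _.
  by rewrite !(tnth_nth i) cshiftE.
rewrite (big_tuple_rcons m F) exchange_big /=; apply: eq_bigr => i _.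
rewrite expmx_walks; apply: eq_bigr => w _; rewrite /F.
case E : (rcons w i) => [|i0 u]; first by case: (tval w) E.
have sE : size (i0 :: u) = m.+1 by rewrite -E size_rcons size_tuple.
rewrite big_ord_recl [RHS]big_ord_recr /= mulrC eqxx; congr (_ * _).
  apply: eq_bigr => k _; rewrite add0n eqSS (ltn_eqF (ltn_ord k)) /=.
  by congr (A _ _); apply: set_nth_default; move: sE => /= [->]; rewrite ?ltnS ?(ltnW (ltn_ord k)) ?ltn_ord.
congr (A _ _).
have := congr1 (fun s => nth i0 s m) E; rewrite nth_rcons size_tuple ltnn eqxx => ->.
by [].
Qed.

End TraceWalks.

Lemma ord_gtF n (i j : 'I_n) : (i < j)%N -> (j == i) = false.
Proof. by move=> ij; rewrite -val_eqE gtn_eqF. Qed.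

Lemma ord_ltF n (i j : 'I_n) : (i < j)%N -> (i == j) = false.
Proof. by move=> ij; rewrite -val_eqE ltn_eqF. Qed.

Section HermitianGaussian.
Local Open Scope complex_scope.
Local Open Scope ring_scope.
Context (R : realType) d (T : measurableType d) (P : probability T R) (n : nat).
Variables (b : 'I_n -> 'I_n -> R) (X : T -> 'M[R[i]]_n).
Hypothesis b_ge0 : forall i j, 0 <= b i j.
Hypothesis b_sym : forall i j, b i j = b j i.
Hypothesis X_herm : forall w, X w \is hermsymmx.
Hypothesis X_indep : mutually_independent P
  [set p : 'I_n * 'I_n | (p.2 <= p.1)%N]%SET (fun p w => reim (X w p.1 p.2)).
Hypothesis X_offdiag : forall i j : 'I_n, (j < i)%N ->
  normalC_law P (fun w => X w i j) (b i j ^+ 2).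
Hypothesis X_diag : forall i : 'I_n,
  normalR_law P (fun w => X w i i) (b i i ^+ 2).

Local Notation I := (('I_n * 'I_n) * bool)%type.

(* [(p, false)] and [(p, true)] index the real and imaginary parts of the entry
   [p] of the lower triangle; above the diagonal the coordinates are zero. *)
Definition coordinate (q : I) (w : T) : measurableTypeR R :=
  if (q.1.2 <= q.1.1)%N then
    if q.2 then complex.Im (X w q.1.1 q.1.2) else complex.Re (X w q.1.1 q.1.2)
  else 0.

(** Coordinates that vanish get variance [0], so that all of them together form one independent
    Gaussian family indexed by a full product. *)
Definition coordinate_variance (q : I) : R :=
  if (q.1.2 <= q.1.1)%N then
    if q.1.1 == q.1.2 then if q.2 then 0 else b q.1.1 q.1.2 ^+ 2
    else b q.1.1 q.1.2 ^+ 2 / 2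
  else 0.

Definition lower (i j : 'I_n) := if (j <= i)%N then (i, j) else (j, i).

Definition entry_form (i j : 'I_n) (q : I) : R[i] :=
  (q.1 == lower i j)%:R *
  (if q.2 then if (j <= i)%N then 'i%C else - 'i%C else 1).

Lemma coordinate_variance_ge0 q : 0 <= coordinate_variance q.
Proof.
rewrite /coordinate_variance; do 3?case: ifP => _ //; rewrite ?divr_ge0 ?sqr_ge0 //.
Qed.

Lemma lower_le i j : ((lower i j).2 <= (lower i j).1)%N.
Proof. by rewrite /lower; case: (leqP j i) => //= /ltnW. Qed.

Lemma sum_pair_bool (V : nmodType) (J : finType) (F : J * bool -> V) :
  \sum_q F q = \sum_p (F (p, true) + F (p, false)).
Proof.
rewrite (eq_bigr (fun q => F (q.1, q.2))) => [|[] //].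
rewrite -(pair_bigA _ (fun p c => F (p, c))) /=.
by apply: eq_bigr => p _; rewrite big_bool.
Qed.

Lemma entryE w i j : X w i j = \sum_q entry_form i j q * (coordinate q w)%:C.
Proof.
rewrite sum_pair_bool (bigD1 (lower i j)) //= big1 ?addr0; last first.
  by move=> p /negPf ne; rewrite /entry_form /= ne !mul0r addr0.
rewrite /entry_form /= eqxx !mul1r /coordinate /= lower_le /lower.
case: ifPn => _ /=; first by rewrite addrC -complexE.
have /is_hermitianmxP /matrixP /(_ i j) := X_herm w.
rewrite !mxE expr0 mul1r => ->.
rewrite [X in (X)^*%R](complexE (X w j i)).
by case: (X w j i) => x y; simpc.
Qed.

(** Off the diagonal, the real and imaginary parts cancel in the square of an entry and add up in
    its product with its conjugate. Hence an entry is correlated only with the transposed one. *)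
Lemma entry_cov i j k l :
  \sum_q (coordinate_variance q)%:C * entry_form i j q * entry_form k l q
  = ((k == j) && (l == i))%:R * (b i j)%:C * (b k l)%:C.
Proof.
rewrite sum_pair_bool (bigD1 (lower i j)) //= big1 ?addr0; last first.
  by move=> p /negPf ne; rewrite /entry_form /= ne !(mul0r, mulr0) addr0.
rewrite /entry_form /= eqxx !mul1r !mulr1 /coordinate_variance /= lower_le.
have bC x y : (b x y ^+ 2)%:C = (b x y)%:C * (b x y)%:C by rewrite expr2 rmorphM.
have bC2 x y : (b x y ^+ 2 / 2)%:C = (b x y)%:C * (b x y)%:C / 2.
  by rewrite rmorphM fmorphV /= bC rmorph_nat.
have ii : 'i%C * 'i%C = -1 :> R[i] by rewrite -expr2 sqr_i.
rewrite /lower; case: (leqP j i) => ji; case: (leqP l k) => lk /=.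
- have [[ik jl]|ne] := eqVneq (i, j) (k, l).
    subst k l; rewrite mul1r mulr1; case: (eqVneq i j) => [ij|ij] /=.
      by rewrite !mul0r add0r bC mul1r.
    by rewrite !mul0r -mulrA ii bC2 mulrN1 addNr.
  rewrite !(mul0r, mulr0) addr0; case: eqP => [kj|_]; last by rewrite !mul0r.
  case: eqP => [li|_]; last by rewrite !mul0r.
  case/eqP: ne; subst k l; congr (_, _); apply: val_inj => /=; lia.
- have [[il jk]|ne] := eqVneq (i, j) (l, k).
    subst l k; rewrite !eqxx mul1r /= mulr1 (ord_gtF _) //.
    by rewrite -mulrA mulrN ii opprK mulr1 bC2 mul1r [b j i]b_sym; field.
  rewrite !(mul0r, mulr0) addr0; case: eqP => [kj|_]; last by rewrite !mul0r.
  case: eqP => [li|_]; last by rewrite !mul0r.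
  by case/eqP: ne; subst k l.
- have [[jk il]|ne] := eqVneq (j, i) (k, l).
    subst l k; rewrite !eqxx mul1r /= mulr1 (ord_gtF _) //.
    by rewrite -mulrA mulNr ii opprK mulr1 bC2 mul1r [b i j]b_sym; field.
  rewrite !(mul0r, mulr0) addr0; case: eqP => [kj|_]; last by rewrite !mul0r.
  case: eqP => [li|_]; last by rewrite !mul0r.
  by case/eqP: ne; subst k l.
- have [[jl ik]|ne] := eqVneq (j, i) (l, k).
    subst k l; rewrite mul1r mulr1 (ord_gtF ji) (ord_ltF ji) /=.
    by rewrite !mul0r -mulrA mulrNN ii bC2 mulrN1 addNr.
  rewrite !(mul0r, mulr0) addr0; case: eqP => [kj|_]; last by rewrite !mul0r.
  case: eqP => [li|_]; last by rewrite !mul0r.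
  by subst k l; lia.
Qed.

Lemma has_law_cst0 (Y : T -> measurableTypeR R) :
  (forall w, Y w = 0) -> has_law P Y (normalR 0).
Proof.
move=> Y0; have -> : Y = cst 0 by apply/funext.
split=> [|A mA]; first exact: measurable_cst.
rewrite /normalR eqxx /= diracE preimage_cst.
by case: ifPn => _; rewrite ?probability_setT ?measure0.
Qed.

Lemma coordinate_law q : has_law P (coordinate q) (normalR (coordinate_variance q)).
Proof.
rewrite /coordinate /coordinate_variance; case: q => [[i j] c] /=.
case: (leqP j i) => [ji|_]; last exact: has_law_cst0.
case: (eqVneq i j) ji => [<-|ij] ji.
  by have [X0 XR] := X_diag i; case: c; [exact: has_law_cst0 | exact: XR].
have lt : (j < i)%N by rewrite ltn_neqAle ji andbT eq_sym.
by have [XR XI _] := X_offdiag lt; case: c.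
Qed.

Lemma coordinate_indep2 (p : 'I_n * 'I_n) (A B : set (measurableTypeR R)) :
  measurable A -> measurable B ->
  (P (coordinate (p, true) @^-1` A `&` coordinate (p, false) @^-1` B)
   = P (coordinate (p, true) @^-1` A) * P (coordinate (p, false) @^-1` B))%E.
Proof.
move=> mA mB.
have cst_case : (forall w, coordinate (p, true) w = 0) ->
  (P (coordinate (p, true) @^-1` A `&` coordinate (p, false) @^-1` B)
   = P (coordinate (p, true) @^-1` A) * P (coordinate (p, false) @^-1` B))%E.
  move=> c0; have -> : coordinate (p, true) = cst 0 by apply/funext.
  rewrite preimage_cst; case: ifPn => _.
    by rewrite setTI probability_setT mul1e.
  by rewrite set0I measure0 mul0e.
case: (leqP p.2 p.1) => [le|gt]; last first.
  by apply: cst_case => w; rewrite /coordinate /= leqNgt gt.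
have [E|ne] := eqVneq p.1 p.2.
  apply: cst_case => w; rewrite /coordinate /= le -E.
  by have [X0 _] := X_diag p.1.
have lt : (p.2 < p.1)%N by rewrite ltn_neqAle le andbT eq_sym.
have [_ _ XRI] := X_offdiag lt.
have := XRI B A mB mA; rewrite setIC muleC.
by rewrite /coordinate /= le.
Qed.

Lemma coordinate_indep (B : I -> set (measurableTypeR R)) :
  (forall q, measurable (B q)) ->
  P (\bigcap_q (coordinate q @^-1` B q)) = (\prod_q P (coordinate q @^-1` B q))%E.
Proof.
move=> mB.
(* A coordinate above the diagonal is [0]: either some such event is empty and both sides vanish, or
   all of them are sure and can be left out. *)
have [[q qup qB]|all0] := pselect (exists2 q : I, ~~ (q.1.2 <= q.1.1)%N & ~ B q 0).
  have E : coordinate q @^-1` B q = set0.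
    rewrite -subset0 => w /=; rewrite /coordinate (negPf qup); exact: qB.
  rewrite (bigD1 q) //= E measure0 mul0e.
  rewrite (_ : \bigcap_q _ = set0) ?measure0 // -subset0 => w /(_ q Logic.I).
  by rewrite E.
have up (q : I) : ~~ (q.1.2 <= q.1.1)%N -> coordinate q @^-1` B q = setT.
  move=> qup; apply/seteqP; split=> // w _ /=; rewrite /coordinate (negPf qup).
  by apply: contrapT => qB; apply: all0; exists q.
pose D := [set p : 'I_n * 'I_n | (p.2 <= p.1)%N]%SET.
pose B' (p : 'I_n * 'I_n) : set (measurableTypeR R * measurableTypeR R) :=
  B (p, false) `*` B (p, true).
have mB' p : measurable (B' p) by exact: measurableX.
have pairE p : p \in D -> (fun w => reim (X w p.1 p.2)) @^-1` B' p
    = coordinate (p, true) @^-1` B (p, true) `&` coordinate (p, false) @^-1` B (p, false).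
  rewrite inE => pD; rewrite /coordinate /= pD.
  by apply/seteqP; split=> w /= [].
have := X_indep (subxx D) mB'.
have -> : \bigcap_(p in [set` D]) (fun w => reim (X w p.1 p.2)) @^-1` B' p
    = \bigcap_q (coordinate q @^-1` B q).
  apply/seteqP; split=> w H.
    move=> [p c] _; case: (boolP (p \in D)) => pD.
      have := H p pD; rewrite -[_ w]/(((fun w => reim (X w p.1 p.2)) @^-1` B' p) w).
      by rewrite pairE // => -[]; case: c.
    by rewrite (up (p, c)) //=; move: pD; rewrite inE.
  move=> p pD; rewrite -[_ w]/(((fun w => reim (X w p.1 p.2)) @^-1` B' p) w).
  by rewrite pairE //; split; exact: H.
move=> ->; transitivity (\prod_p (P (coordinate (p, true) @^-1` B (p, true))
    * P (coordinate (p, false) @^-1` B (p, false))))%E.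
  rewrite [RHS](bigID (mem D)) /= [X in (_ * X)%E]big1 ?mule1.
    by apply: eq_bigr => p pD; rewrite pairE // coordinate_indep2.
  move=> p; rewrite inE => pD.
  by rewrite !up ?probability_setT ?mule1.
rewrite [RHS](eq_bigr (fun q => P (coordinate (q.1, q.2) @^-1` B (q.1, q.2)))) => [|[] //].
rewrite -(pair_bigA _ (fun p c => P (coordinate (p, c) @^-1` B (p, c)))) /=.
by apply: eq_bigr => p _; rewrite big_bool.
Qed.

Lemma trace_expectation p (S2 T2 : R) : (0 < p)%N -> 0 <= T2 ->
    (forall i, \sum_j b i j ^+ 2 <= S2) -> (forall i j, b i j ^+ 2 <= T2) ->
  exists2 z : R, has_expectation P (fun w => \tr (X w ^+ p.*2)) z%:C &
    z <= \sum_(a in pairings p.*2)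
      n%:R * S2 ^+ (#|porbits (vertices a)|.-1) * T2 ^+ (p.+1 - #|porbits (vertices a)|).
Proof.
move=> p0 T20 S2P T2P; set m := p.*2.
have m0 : (0 < m)%N by rewrite /m; lia.
pose l (u : m.-tuple 'I_n) (x : 'I_m) := entry_form (tnth u x) (tnth u (cshift m x)).
pose vC (q : I) := (coordinate_variance q)%:C.
pose E u := multilin (l u) (monomial_moment vC) (index_enum 'I_m).
have HE : has_expectation P (fun w => \tr (X w ^+ m)) (\sum_u E u).
  have -> : (fun w => \tr (X w ^+ m)) = (fun w => \sum_(u : m.-tuple 'I_n)
      \prod_x \sum_q l u x q * (coordinate q w)%:C).
    apply/funext => w; rewrite mxtrace_walks //; apply: eq_bigr => u _.
    by apply: eq_bigr => x _; rewrite entryE.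
  apply: has_expectation_sum => u.
  apply: wick_expectation.
  - exact: coordinate_variance_ge0.
  - exact: coordinate_law.
  - exact: coordinate_indep.
have leE u : E u <= (#|[set a in pairings m | compatible a u]%SET|)%:R
    * \prod_x (b (tnth u x) (tnth u (cshift m x)))%:C.
  (* The sides [x] and [y] carry transposed entries. A matching along [K] is a pairing with which
     [u] is compatible. *)
  pose K (x y : 'I_m) := (tnth u y == tnth u (cshift m x)) && (tnth u (cshift m y) == tnth u x).
  have K_sym : symmetric K.
    by move=> x y; rewrite /K andbC ![tnth u (cshift m _) == _]eq_sym.
  have := @wick_le _ _ vC m (l u) K
    (fun x => (b (tnth u x) (tnth u (cshift m x)))%:C) K_sym _ _ (index_enum 'I_m) (index_enum_uniq _).
  move=> H; apply: le_trans (H _ _) _ => {H}.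
  - by move=> x; rewrite ler0c.
  - by move=> x y; rewrite -entry_cov.
  apply: ler_wpM2r; first by apply: prodr_ge0 => x _; rewrite ler0c.
  rewrite ler_nat; apply/subset_leq_card/fintype.subsetP => a /matchingsP H.
  have {}H x : [/\ a (a x) = x, a x != x & K x (a x)].
    by have := H x; rewrite inE mem_index_enum => -[-> [-> ->]].
  rewrite inE; apply/andP; split.
    by apply/pairingsP; split=> x; have [] := H x.
  by apply/forallP => x; have [_ _ /andP [_]] := H x; rewrite /vertices permM.
have sumE : \sum_u E u <= (\sum_(a in pairings m)
      n%:R * S2 ^+ (#|porbits (vertices a)|.-1) * T2 ^+ (p.+1 - #|porbits (vertices a)|))%:C.
  apply: (@le_trans _ _ (\sum_(u : m.-tuple 'I_n)
      #|[set a in pairings m | compatible a u]%SET|%:R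
      * \prod_x (b (tnth u x) (tnth u (cshift m x)))%:C)).
    by apply: ler_sum => u _; exact: leE.
  have -> : \sum_(u : m.-tuple 'I_n) #|[set a in pairings m | compatible a u]%SET|%:R
      * \prod_x (b (tnth u x) (tnth u (cshift m x)))%:C
    = (\sum_(a in pairings m) \sum_(u | compatible a u)
        \prod_x b (tnth u x) (tnth u (cshift m x)))%:C.
    rewrite (exchange_big_dep xpredT) //= rmorph_sum; apply: eq_bigr => u _.
    rewrite -rmorph_prod -sum1_card natr_sum mulr_suml rmorph_sum.
    by apply: eq_big => a; rewrite ?inE // mul1r.
  rewrite lecR; apply: ler_sum => a pa.
  exact: walk_sum_le.
(* The order of [R[i]] relates only numbers with equal imaginary parts, so the bound itself shows
   that the expectation is real. *)
move: HE sumE; case: (\sum_u E u) => x y HE.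
rewrite lecE /= => /andP [/eqP y0 le]; exists x => //.
by move: HE; rewrite -y0.
Qed.

End HermitianGaussian.

(** * The spectral norm of a Hermitian matrix *)

Section Diagonalized.
Variables (F : fieldType) (n : nat) (Q : 'M[F]_n).
Hypothesis Q_unit : Q \in unitmx.

Lemma expmx_diag (D : 'rV[F]_n) k :
  (invmx Q *m diag_mx D *m Q) ^+ k = invmx Q *m diag_mx (\row_i D 0 i ^+ k) *m Q.
Proof.
elim: k => [|k IH].
  rewrite expr0 (_ : diag_mx _ = 1%:M) ?mulmx1 ?mulVmx //.
  by apply/matrixP => i j; rewrite !mxE expr0.
rewrite exprSr IH -[_ * _]/(_ *m _) !mulmxA mulmxK // -[_ *m diag_mx _ *m diag_mx _]mulmxA.
congr (_ *m _ *m _); apply/matrixP => i j.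
rewrite mulmx_diag !mxE; case: eqP => [->|_]; first by rewrite !mulr1n exprSr.
by rewrite !mulr0n.
Qed.

Lemma mxtrace_expmx_diag (D : 'rV[F]_n) k :
  \tr ((invmx Q *m diag_mx D *m Q) ^+ k) = \sum_i D 0 i ^+ k.
Proof.
rewrite expmx_diag mxtrace_mulC mulmxA mulmxV // mul1mx mxtrace_diag.
by apply: eq_bigr => i _; rewrite mxE.
Qed.

Lemma eigenvalue_diag (D : 'rV[F]_n) a :
  reflect (exists i, D 0 i = a) (eigenvalue (invmx Q *m diag_mx D *m Q) a).
Proof.
apply: (iffP eigenvalueP) => [[v Ev v0]|[i Di]].
  pose u := v *m invmx Q.
  have u0 : u != 0.
    apply: contraNneq v0 => E; rewrite -(mulmxKV Q_unit v) -/u E mul0mx //.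
  have Eu : u *m diag_mx D = a *: u.
    by rewrite /u scalemxAl -Ev !mulmxA mulmxK.
  have /rV0Pn [i ui] := u0; exists i; apply: (mulfI ui).
  have := congr1 (fun M : 'rV_n => M 0 i) Eu.
  by rewrite mul_mx_diag !mxE mulrC => ->; rewrite mulrC.
exists (row i Q).
  rewrite rowE !mulmxA (mulmxK Q_unit) scalemxAl; congr (_ *m _).
  apply/rowP => j; rewrite mul_mx_diag !mxE eqxx /=.
  by case: eqP => [->|_]; rewrite ?mul1r ?mulr1 ?mul0r ?mulr0.
apply/eqP => E; have : (delta_mx 0 i : 'rV[F]_n) = 0.
  by rewrite -(mulmxK Q_unit (delta_mx 0 i)) -rowE E mul0mx.
by move=> /rowP /(_ i); rewrite !mxE !eqxx => /eqP; rewrite oner_eq0.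
Qed.

End Diagonalized.

Section SpectralNorm.
Local Open Scope complex_scope.
Local Open Scope ring_scope.
Variables (R : realType) (n : nat) (A : 'M[R[i]]_n).
Hypothesis A_herm : A \is hermsymmx.

Lemma hermitian_eigenvalues : exists e : 'I_n -> R,
  (forall k, \tr (A ^+ k) = (\sum_i e i ^+ k)%:C) /\
  singular_values A = [set `|e i| | i in [set: 'I_n]].
Proof.
pose Q := spectralmx A; pose D := spectral_diag A.
have Q_unit : Q \in unitmx := spectral_unit A.
have AE : A = invmx Q *m diag_mx D *m Q by apply/orthomx_spectralP/hermitian_normalmx.
have Dreal i : D 0 i \is Num.real.
  by have /mxOverP := hermitian_spectral_diag_real A_herm; exact.
pose e i := complex.Re (D 0 i).
have DE i : D 0 i = (e i)%:C by rewrite /e RRe_real.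
exists e; split=> [k|].
  rewrite {1}AE mxtrace_expmx_diag // rmorph_sum; apply: eq_bigr => i _.
  by rewrite DE rmorphXn.
have AAE : (A ^t* *m A)%sesqui = invmx Q *m diag_mx (\row_i D 0 i ^+ 2) *m Q.
  have /is_hermitianmxP := A_herm; rewrite expr0 scale1r => <-.
  by rewrite -expmx_diag // -AE expr2.
apply/seteqP; split=> s; rewrite /singular_values /= AAE.
  case=> s0 ev; have [j] := elimT (eigenvalue_diag Q_unit _ _) ev; rewrite mxE DE -rmorphXn /= => /complexI E.
  exists j => //; apply/eqP; rewrite -(eqrXn2 (n := 2)) //.
  by rewrite real_normK ?num_real // E.
case=> i _ <-; split=> //; apply: (introT (eigenvalue_diag Q_unit _ _)); exists i.
by rewrite mxE DE -rmorphXn /= real_normK ?num_real.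
Qed.

(** The lower bound on the trace is for Markov's inequality, the upper one for the measurability of
    the norm. *)
Lemma spectral_norm_trace p : (0 < n)%N ->
  spectral_norm A ^+ p.*2 <= complex.Re (\tr (A ^+ p.*2)) /\
  complex.Re (\tr (A ^+ p.*2)) <= n%:R * spectral_norm A ^+ p.*2.
Proof.
move=> n0; have [e [trE SE]] := hermitian_eigenvalues.
pose j := [arg max_(i > Ordinal n0) `|e i|]%O.
have jmax i : `|e i| <= `|e j| by rewrite /j; case: arg_maxP => // k _; exact.
have normE : spectral_norm A = `|e j|.
  rewrite /spectral_norm SE; apply/eqP; rewrite eq_le; apply/andP; split.
    by apply: ge_sup => [|_ [i _ <-]]; [exists `|e j|; exists j | exact: jmax].
  apply: ub_le_sup; last by exists j.
  by exists `|e j| => _ [i _ <-]; exact: jmax.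
have sqE i : e i ^+ p.*2 = `|e i| ^+ p.*2.
  by rewrite -mul2n !exprM real_normK ?num_real.
rewrite normE trE /=; split.
  rewrite -sqE (bigD1 j) //= lerDl; apply: sumr_ge0 => i _.
  by rewrite sqE exprn_ge0.
rewrite -[X in X%:R]card_ord -sumr_const mulr_suml.
apply: ler_sum => i _; rewrite mul1r sqE.
by apply: lerXn2r; rewrite ?nnegrE.
Qed.

Lemma spectral_norm_ge0 : (0 < n)%N -> 0 <= spectral_norm A.
Proof.
move=> n0; have [e [_ SE]] := hermitian_eigenvalues.
rewrite /spectral_norm SE; apply: (@le_trans _ _ `|e (Ordinal n0)|) => //.
apply: ub_le_sup; last by exists (Ordinal n0).
exists (\sum_i `|e i|) => _ [i _ <-].
by rewrite (bigD1 i) //= lerDl sumr_ge0.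
Qed.

End SpectralNorm.

(** * The tail bound *)

Lemma central_bin_rec p : (p.+1 * 'C(p.+1.*2, p.+1) = 2 * (p.*2.+1 * 'C(p.*2, p)))%N.
Proof.
have E1 : (p.*2.+1 * 'C(p.*2, p) = p.+1 * 'C(p.*2.+1, p.+1))%N.
  by rewrite (mul_bin_diag p.*2.+1 p).
have E2 : 'C(p.*2.+1, p) = 'C(p.*2.+1, p.+1).
  by rewrite -(@bin_sub p.*2.+1 p.+1); [congr 'C(_, _); lia | lia].
by rewrite E1 doubleS binS E2; lia.
Qed.

(** The ratio of consecutive terms is at most [16] because [(2p + 1) (2p + 3) <= 4 (p + 1) ^ 2]. *)
Lemma central_bin_sqr_le p : ('C(p.*2, p) ^ 2 * p.*2.+1 <= 16 ^ p)%N.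
Proof.
elim: p => [|p IH]; first by rewrite bin0.
have := central_bin_rec p; move: 'C(p.+1.*2, p.+1) 'C(p.*2, p) IH => C' C IH E.
rewrite -(leq_pmul2l (m := p.+1 ^ 2)) ?expn_gt0 //.
have -> : (p.+1 ^ 2 * (C' ^ 2 * p.+1.*2.+1) = 4 * (p.*2.+1 * p.+1.*2.+1) * (C ^ 2 * p.*2.+1))%N.
  rewrite mulnA -expnMn E -!mul2n; ring.
rewrite (expnS 16) [leqRHS]mulnA; apply: leq_mul => //.
by rewrite -mulnn -!mul2n; lia.
Qed.

(** The bound [4 ^ p p ^ (-3/2)] on Catalan numbers, squared to remain in [nat]. *)
Lemma card_layer0_sqr_le p : (0 < p)%N -> (#|layer p 0| ^ 2 * p ^ 3 <= 16 ^ p)%N.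
Proof.
move=> p0; have := card_layer0 p0; have := central_bin_sqr_le p.
move: 'C(p.*2, p) #|layer p 0| => C L H1 H2.
apply: leq_trans H1; apply: (@leq_trans ((p.+1 * L) ^ 2 * p.*2.+1)).
  by rewrite expnMn -mul2n; nia.
by rewrite leq_mul2r leq_sqr H2 orbT.
Qed.

(** * Numerical estimates *)

Section Numeric.
Variable R : realType.

Lemma bin_double3 (p : nat) : (0 < p)%N ->
  'C(p.*2, 3)%:R * 3 = p%:R * (2 * p%:R - 1) * (2 * p%:R - 2) :> R.
Proof.
case: p => // k _; have := bin_ffact k.+1.*2 3.
rewrite doubleS !ffactnS /= ffactn0 muln1 => /(congr1 (fun u => u%:R : R)) /=.
have e0 : (2 * k)%:R = 2 * k%:R :> R by rewrite natrM.
have e1 : (2 * k).+1%:R = 2 * k%:R + 1 :> R by rewrite -natr1 e0.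
have e2 : (2 * k).+2%:R = 2 * k%:R + 2 :> R by rewrite -addn2 natrD e0.
have e3 : k.+1%:R = k%:R + 1 :> R by rewrite -natr1.
rewrite -!mul2n natrM (natrM R (2 * k).+2) (natrM R (2 * k).+1) e0 e1 e2 e3 (_ : 3`! = 6%N) //.
by move: 'C(_, _)%:R k%:R => c x; lra.
Qed.

(** Replacing [p] by [y s + 1] in the first term and by [y s] in the second leaves at most [(2/3) s
    ^ 3 + 1 + 1/3 - 2 s ^ 3 = (4/3) (1 - s ^ 3)], and [s >= 1]. *)
Lemma exponent_le (p : nat) (y s : R) :
    1 <= s -> s ^+ 2 <= y -> y * s <= p%:R -> p%:R <= y * s + 1 ->
  'C(p.*2, 3)%:R * (y ^+ 3)^-1 / 2 - p.*2%:R * (s ^+ 2 / y) <= 1 - s ^+ 3.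
Proof.
move=> s1 sy Yp pY; set q : R := p%:R.
have y1 : 1 <= y by nra.
have y0 : 0 < y by lra.
set Y := y * s in Yp pY.
have Y1 : 1 <= Y by rewrite /Y; nra.
have q1 : 1 <= q by apply: le_trans Yp.
have p0 : (0 < p)%N by rewrite -(ltr_nat R); apply: lt_le_trans q1.
have binE := bin_double3 p0; rewrite -/q in binE.
have -> : 'C(p.*2, 3)%:R = q * (2 * q - 1) * (2 * q - 2) / 3 :> R by rewrite -binE mulfK.
have -> : p.*2%:R = 2 * q :> R by rewrite -mul2n natrM.
have H1 : q * (2 * q - 1) * (2 * q - 2) / 3 * (y ^+ 3)^-1 / 2
   <= (2 * Y ^+ 3 + 3 * Y ^+ 2 + Y) / 3 * (y ^+ 3)^-1.
  rewrite mulrAC ler_wpM2r ?invr_ge0 ?exprn_ge0 ?(ltW y0) //.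
  have h1 : q * (2 * q - 1) <= (Y + 1) * (2 * Y + 1) by apply: ler_pM; lra.
  have h2 : q * (2 * q - 1) * (q - 1) <= (Y + 1) * (2 * Y + 1) * Y.
    apply: ler_pM => //; [apply: mulr_ge0|..]; lra.
  have -> : 2 * Y ^+ 3 + 3 * Y ^+ 2 + Y = (Y + 1) * (2 * Y + 1) * Y by ring.
  by lra.
have H2 : (2 * Y ^+ 3 + 3 * Y ^+ 2 + Y) / 3 * (y ^+ 3)^-1 = 2 / 3 * s ^+ 3 + s ^+ 2 / y + s / 3 / y ^+ 2.
  by rewrite /Y; field; lra.
have H3 : s ^+ 2 / y <= 1 by rewrite ler_pdivrMr // mul1r.
have H4 : s / 3 / y ^+ 2 <= 1 / 3.
  rewrite ler_pdivrMr ?exprn_gt0 //; nra.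
have H5 : 2 * s ^+ 3 <= 2 * q * (s ^+ 2 / y).
  rewrite mulrA ler_pdivlMr //.
  have -> : 2 * s ^+ 3 * y = 2 * Y * s ^+ 2 by rewrite /Y; ring.
  by rewrite ler_wpM2r ?sqr_ge0 //; lra.
have H6 : 1 <= s ^+ 3 by rewrite exprn_ege1.
lra.
Qed.

Lemma expR1_le3 : expR 1 <= 3 :> R.
Proof.
(* Inverts [exp (- 1/8) >= 7/8]; the eighth power of [8/7] is about [2.91]. *)
have h : expR (1 / 8) <= 8 / 7 :> R.
  have := expR_ge1Dx (- (1 / 8) : R); rewrite expRN => H.
  rewrite -[expR _]invrK -[leRHS]invrK lef_pV2 ?posrE ?invr_gt0 ?expR_gt0 //; lra.
have -> : (1 : R) = 8%:R * (1 / 8) by field.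
rewrite expRM_natl; apply: (@le_trans _ _ ((8 / 7) ^+ 8)); last by lra.
by apply: lerXn2r; rewrite ?nnegrE ?expR_ge0 //; lra.
Qed.

Lemma expR_le_1D2x (x : R) : 0 <= x -> x <= 1 -> expR x <= 1 + 2 * x.
Proof.
move=> x0 x1; have := convex_expR (Itv01 x0 x1) 1 0.
rewrite !convRE /= mulr0 addr0 mulr1 expR0 mulr1 => H.
apply: le_trans H _; have := expR1_le3; rewrite /unstable.onem.
by have := expR_ge0 (1 : R); nra.
Qed.

End Numeric.

Lemma pairing_sum_le (R : realType) (p : nat) (S2 T2 : R) : (0 < p)%N ->
    0 < S2 -> 0 <= T2 ->
  \sum_(a in pairings p.*2) S2 ^+ (#|porbits (vertices a)|.-1)
     * T2 ^+ (p.+1 - #|porbits (vertices a)|)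
  <= S2 ^+ p * (#|layer p 0|%:R * expR ('C(p.*2, 3)%:R * (T2 / S2) ^+ 2 / 2)).
Proof.
move=> p0 S20 T20; have x0 : 0 <= T2 / S2 by rewrite divr_ge0 // ltW.
apply: le_trans (ler_wpM2l (exprn_ge0 _ (ltW S20)) (genus_sum_le p0 x0)).
rewrite mulr_sumr; apply: ler_sum => a pa.
have V0 : (0 < #|porbits (vertices a)|)%N.
  apply/card_gt0P; have lt0 : (0 < p.*2)%N by rewrite double_gt0.
  by exists (porbit (vertices a) (Ordinal lt0)); rewrite imset_f.
have := card_trisections p0 pa; move: #|trisections a| #|porbits _| V0 => t V V0 E.
set k := (p.+1 - V)%N; have Ep : p = (V.-1 + k)%N by rewrite /k; lia.
rewrite [X in _ <= S2 ^+ X * _]Ep exprD expr_div_n -mulrA.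
rewrite ler_wpM2l ?exprn_ge0 ?(ltW S20) // mulrCA divff ?mulr1 //.
by rewrite expf_neq0 // gt_eqF.
Qed.

(** * Markov's inequality and measurability of the norm *)

Section Markov.
Context (R : realType) d (T : measurableType d) (P : probability T R).

Lemma markov_ge0 (f : T -> R) (z c : R) : 0 < c -> (forall w, 0 <= f w) ->
    P.-integrable setT (EFin \o f) -> (\int[P]_w (f w)%:E = z%:E)%E ->
  (P [set w | (c <= f w)%R] <= (z / c)%:E)%E.
Proof.
move=> c0 f0 fi fz; have mf : measurable_fun setT (EFin \o f) := measurable_int _ fi.
have := @le_integral_comp_abse _ _ _ P setT measurableT (EFin \o f) c idfun.
move=> /(_ (@measurable_id _ _ _) (fun _ => id) (fun _ _ _ _ => id) mf c0).
rewrite setTI (_ : [set x | _] = [set w | c <= f w]); last first.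
  by apply/seteqP; split=> w /=; rewrite lee_fin ger0_norm.
rewrite (eq_integral (EFin \o f)); last by move=> w _; rewrite /= ger0_norm.
by rewrite /= fz EFinM muleC -lee_pdivlMr.
Qed.

(** The event is the union over [p >= 1] of the events [n c ^ 2p < tr (X ^ 2p)]: if the norm exceeds
    [c], its ratio to [c] has powers above [n], by Bernoulli's inequality. *)
Lemma measurable_spectral_norm_gt n (X : T -> 'M[R[i]]_n) (c : R) :
    (0 < n)%N -> 0 < c -> (forall w, X w \is hermsymmx) ->
    (forall p, (0 < p)%N ->
      measurable_fun setT (fun w => complex.Re (\tr (X w ^+ p.*2)))) ->
  measurable [set w | c < spectral_norm (X w)].
Proof.
move=> n0 c0 XH mX.
rewrite (_ : [set w | _] = \bigcup_p [set w | n%:R * c ^+ p.+1.*2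
    < complex.Re (\tr (X w ^+ p.+1.*2))]).
  apply: bigcup_measurable => p _.
  rewrite (_ : [set w | _] = setT `&` (fun w => complex.Re (\tr (X w ^+ p.+1.*2)))
      @^-1` `]n%:R * c ^+ p.+1.*2, +oo[).
    exact: (mX p.+1 isT measurableT).
  by apply/seteqP; split=> w /=; rewrite in_itv /= andbT => // -[].
apply/seteqP; split=> w /=; last first.
  case=> p _ /= lt; rewrite ltNge; apply/negP => le; move: lt; apply/negP.
  rewrite -leNgt; have [_ H] := spectral_norm_trace (XH w) p.+1 n0.
  apply: le_trans H _; apply: ler_wpM2l => //.
  by apply: lerXn2r; rewrite ?nnegrE ?(ltW c0) // spectral_norm_ge0.
set s := spectral_norm _ => cs.
pose h := s / c - 1.
have h0 : 0 < h by rewrite subr_gt0 ltr_pdivlMr // mul1r.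
have [k kP] : exists k : nat, n%:R / h < k%:R.
  by exists (Num.truncn (n%:R / h)).+1; rewrite truncnS_gt.
exists k => //=; have [H _] := spectral_norm_trace (XH w) k.+1 n0.
apply: lt_le_trans H; rewrite -/s.
have -> : s = (1 + h) * c by rewrite /h addrC subrK divfK // gt_eqF.
rewrite exprMn ltr_pM2r ?exprn_gt0 //.
have bern j : 1 + j%:R * h <= (1 + h) ^+ j.
  elim: j => [|j IH]; first by rewrite expr0 mul0r addr0.
  rewrite exprS; apply: le_trans (ler_wpM2l _ IH); last by lra.
  rewrite -natr1; have : 0 <= j%:R :> R by []; nra.
apply: lt_le_trans (bern _); rewrite ltr_pdivrMr // in kP.
have : k%:R <= k.+1.*2%:R :> R by rewrite ler_nat; lia.
nra.
Qed.

End Markov.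

Section Params.
Variables (R : realType) (n : nat) (b : 'I_n -> 'I_n -> R).
Hypothesis b_ge0 : forall i j, 0 <= b i j.
Hypothesis b_neq0 : exists i j, b i j != 0.

Lemma sigma_sqr : sigma b ^+ 2 = \big[Num.max/0]_(i < n) \sum_(j < n) b i j ^+ 2.
Proof. by rewrite sqr_sqrtr // bigmax_ge_id. Qed.

Lemma sigma_star_sqr :
  sigma_star b ^+ 2 = \big[Num.max/0]_(i < n) \big[Num.max/0]_(j < n) b i j ^+ 2.
Proof. by rewrite sqr_sqrtr // bigmax_ge_id. Qed.

Lemma row_sum_le i : \sum_j b i j ^+ 2 <= sigma b ^+ 2.
Proof. by rewrite sigma_sqr; exact: (le_bigmax _ (fun i => \sum_j b i j ^+ 2)). Qed.

Lemma entry_le i j : b i j ^+ 2 <= sigma_star b ^+ 2.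
Proof.
rewrite sigma_star_sqr; apply: le_trans (le_bigmax _ _ i).
exact: (le_bigmax _ (fun j => b i j ^+ 2)).
Qed.

Lemma sigma_star_gt0 : 0 < sigma_star b.
Proof.
have [i0 [j0 ne]] := b_neq0; rewrite lt_neqAle sqrtr_ge0 andbT.
apply: contra_neq ne => E; have := entry_le i0 j0; rewrite -E expr0n /= => H.
by apply/eqP; rewrite -sqrf_eq0 eq_le H sqr_ge0.
Qed.

Lemma sigma_star_le : sigma_star b <= sigma b.
Proof.
rewrite -(@ler_pXn2r _ 2) ?nnegrE ?sqrtr_ge0 // sigma_star_sqr.
apply: bigmax_le => [|i _]; first exact: sqr_ge0.
apply: bigmax_le => [|j _]; first exact: sqr_ge0.
apply: le_trans (row_sum_le i); rewrite (bigD1 j) //= lerDl.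
by apply: sumr_ge0 => k _; exact: sqr_ge0.
Qed.

Lemma sigma_sqr_le : sigma b ^+ 2 <= n%:R * sigma_star b ^+ 2.
Proof.
rewrite sigma_sqr; apply: bigmax_le => [|i _].
  by rewrite mulr_ge0 ?sqr_ge0.
apply: (@le_trans _ _ (\sum_(j < n) sigma_star b ^+ 2)).
  by apply: ler_sum => j _; exact: entry_le.
by rewrite sumr_const card_ord mulr_natl.
Qed.

End Params.

Theorem theorem2p3 (R : realType) (d : measure_display) (T : measurableType d)
    (P : probability T R) (n : nat) (b : 'I_n -> 'I_n -> R)
    (X : T -> 'M[R[i]]_n)
    (b_ge0 : forall i j, 0 <= b i j)
    (b_sym : forall i j, b i j = b j i)
    (b_neq0 : exists i j, b i j != 0)
    (X_herm : forall w, X w \is hermsymmx)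
    (X_indep : mutually_independent P
       [set p : 'I_n * 'I_n | (p.2 <= p.1)%N]%SET
       (fun p w => reim (X w p.1 p.2)))
    (X_offdiag : forall i j : 'I_n, (j < i)%N ->
       normalC_law P (fun w => X w i j) (b i j ^+ 2))
    (X_diag : forall i : 'I_n,
       normalR_law P (fun w => X w i i) (b i i ^+ 2))
    (t : R) (t_ge0 : 0 <= t)
    (t_le : t <= sigma b `^ (4 / 3) / sigma_star b `^ (4 / 3)) :
  (P [set w : T |
      2 * sigma b + 4 * sigma_star b `^ (4 / 3) * sigma b `^ (- (1 / 3)) * t
      < spectral_norm (X w)]%R
   <= (expR 1 * n%:R * sigma_star b ^+ 2 / sigma b ^+ 2
       * expR (- (t `^ (3 / 2))))%:E)%E.
Proof.
have n0 : (0 < n)%N.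
  by have [i0 _] := b_neq0; exact: leq_ltn_trans (leq0n i0) (ltn_ord i0).
have s20 := sigma_star_gt0 b_neq0.
have s10 : 0 < sigma b := lt_le_trans s20 (sigma_star_le b).
have s1n := sigma_sqr_le b.
have trE (p : nat) (p0 : (0 < p)%N) := trace_expectation b_ge0 b_sym X_herm
  X_indep X_offdiag X_diag p0 (sqr_ge0 (sigma_star b)) (row_sum_le b) (entry_le b).
move: (sigma b) (sigma_star b) s20 s10 s1n trE t_le => s1 s2 s20 s10 s1n trE t_le.
set A := s1 `^ (4 / 3) in t_le; set B := s2 `^ (4 / 3) in t_le *.
have A0 : 0 < A by exact: powR_gt0.
have B0 : 0 < B by exact: powR_gt0.
have pow4 (s : R) : 0 < s -> (s `^ (4 / 3)) ^+ 3 = s ^+ 4.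
  move=> s0; rewrite -powR_mulrn ?powR_ge0 // -powRrM (_ : 4 / 3 * 3%:R = 4%:R) ?powR_mulrn //; first exact: ltW.
  by field.
have A3 : A ^+ 3 = s1 ^+ 4 := pow4 _ s10.
have B3 : B ^+ 3 = s2 ^+ 4 := pow4 _ s20.
(* The threshold becomes [2 sigma (1 + 2 delta)], and the upper bound on [t] becomes
   [delta <= 1]. *)
pose y := A / B; pose delta := t / y.
have y0 : 0 < y by rewrite divr_gt0.
have delta0 : 0 <= delta by rewrite divr_ge0 // ltW.
have delta1 : delta <= 1 by rewrite ler_pdivrMr // mul1r.
have thetaE : 2 * s1 + 4 * B * s1 `^ (- (1 / 3)) * t = 2 * s1 * (1 + 2 * delta).
  have sA : s1 `^ (- (1 / 3)) = s1 / A.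
    apply: (mulIf (lt0r_neq0 A0)); rewrite divfK ?gt_eqF // /A -powRD; last first.
      by rewrite (gt_eqF s10) implybT.
    by rewrite (_ : _ + _ = 1) ?powRr1 ?(ltW s10) //; lra.
  by rewrite sA /delta /y; field; rewrite !gt_eqF.
rewrite thetaE; set theta := 2 * s1 * _.
have theta0 : 0 < theta by rewrite !mulr_gt0 //; lra.
have mX p : (0 < p)%N -> measurable_fun setT (fun w => complex.Re (\tr (X w ^+ p.*2))).
  move=> p0; have [z [fi _ _ _] _] := trE p p0.
  by apply/measurable_EFinP; exact: measurable_int fi.
have mset := measurable_spectral_norm_gt n0 theta0 X_herm mX.
(* For [t <= 1], [e exp (- t ^ (3/2)) >= 1], and [n sigma_star ^ 2 >= sigma ^ 2] as a row has [n]
   entries. *)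
have [t1|t1] := leP t 1.
  apply: le_trans (probability_le1 P mset) _; rewrite lee_fin.
  have h1 : expR 1 * expR (- (t `^ (3 / 2))) >= 1 :> R.
    have t32 : t `^ (3 / 2) <= 1.
      have := @ge0_ler_powR _ (3 / 2 : R) _ t 1; rewrite powR1; apply; rewrite ?nnegrE //; lra.
    by rewrite -expRD -[leLHS]expR0 ler_expR subr_ge0.
  have h2 : 1 <= n%:R * s2 ^+ 2 / s1 ^+ 2 by rewrite ler_pdivlMr ?exprn_gt0 // mul1r.
  have -> : expR 1 * n%:R * s2 ^+ 2 / s1 ^+ 2 * expR (- t `^ (3 / 2))
    = (expR 1 * expR (- (t `^ (3 / 2)))) * (n%:R * s2 ^+ 2 / s1 ^+ 2) by ring.
  by rewrite -[leLHS]mulr1 ler_pM.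
pose s := Num.sqrt t.
have st : s ^+ 2 = t by rewrite sqr_sqrtr.
have s1' : 1 <= s by rewrite -(sqrtr1 R) ler_wsqrtr // ltW.
have t32 : t `^ (3 / 2) = s ^+ 3.
  by rewrite /s -powR12_sqrt // -powR_mulrn ?powR_ge0 // -powRrM; congr (_ `^ _); lra.
have sy : s ^+ 2 <= y by rewrite st.
have y1 : 1 <= y by nra.
pose p := (Num.truncn (y * s)).+1.
have ys0 : 0 <= y * s by rewrite mulr_ge0 //; lra.
have Yp : y * s <= p%:R by exact/ltW/truncnS_gt.
have pY : p%:R <= y * s + 1 by rewrite -natr1 lerD2r truncn_le.
have yp : y <= p%:R by apply: le_trans Yp; nra.
have p0 : (0 < p)%N by [].
have [z [fi _ fz _] z_le] := trE p p0.
have theta_p0 : 0 < theta ^+ p.*2 by rewrite exprn_gt0.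
have f_ge w : spectral_norm (X w) ^+ p.*2 <= complex.Re (\tr (X w ^+ p.*2)).
  by have [] := spectral_norm_trace (X_herm w) p n0.
have norm0 w : 0 <= spectral_norm (X w) := spectral_norm_ge0 (X_herm w) n0.
apply: (@le_trans _ _ (P [set w | theta ^+ p.*2 <= complex.Re (\tr (X w ^+ p.*2))])).
  apply: le_measure; first exact/mem_set.
  - apply/mem_set; rewrite (_ : [set w | _] = setT `&` (fun w => complex.Re (\tr (X w ^+ p.*2)))
      @^-1` `[theta ^+ p.*2, +oo[).
      exact: (mX p p0 measurableT).
    by apply/seteqP; split=> w /=; rewrite in_itv /= andbT => // -[].
  - move=> w /= lt; apply: le_trans (f_ge w).
  by apply: lerXn2r; rewrite ?nnegrE ?(ltW theta0) // ltW.
apply: le_trans (markov_ge0 theta_p0 _ fi fz) _.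
  by move=> w; apply: le_trans (f_ge w); exact: exprn_ge0.
rewrite lee_fin ler_pdivrMr //; apply: le_trans z_le _.
under eq_bigr do rewrite -mulrA; rewrite -mulr_sumr.
set x := s2 ^+ 2 / s1 ^+ 2.
have x0 : 0 < x by rewrite divr_gt0 ?exprn_gt0.
have xy : x ^+ 2 = (y ^+ 3)^-1.
  by rewrite /x /y !expr_div_n A3 B3 invf_div -!exprM.
apply: le_trans (ler_wpM2l _ (pairing_sum_le p0 (exprn_gt0 2 s10) (sqr_ge0 s2))) _ => //.
rewrite -/x xy.
set E := _ * _ / 2; set L : R := #|layer p 0|%:R.
(* From [p >= y] and [y ^ (-3/2) = x], compared after squaring to avoid fractional powers. *)
have LE : L <= 4 ^+ p * x.
  have L0 : 0 <= L by [].
  have x40 : 0 <= 4 ^+ p * x by rewrite mulr_ge0 ?exprn_ge0 ?(ltW x0).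
  rewrite -(@ler_pXn2r _ 2) // exprMn xy.
  rewrite ler_pdivlMr ?exprn_gt0 //.
  have := card_layer0_sqr_le p0; rewrite -(ler_nat R) natrM !natrX -/L => H.
  rewrite -exprM mulnC exprM (_ : 4 ^+ 2 = 16%:R); last by ring.
  apply: le_trans _ H; rewrite ler_wpM2l ?sqr_ge0 //.
  by apply: lerXn2r; rewrite ?nnegrE // ltW.
have EE : expR E <= expR 1 * expR (- s ^+ 3) * expR (p.*2%:R * delta).
  by rewrite -!expRD ler_expR -lerBlDr /delta -{1}st; exact: exponent_le.
(* [exp delta <= 1 + 2 delta], raised to the power [2p]. *)
have thE : 4 ^+ p * s1 ^+ 2 ^+ p * expR (p.*2%:R * delta) <= theta ^+ p.*2.
  rewrite /theta [leRHS]exprMn expRM_natl.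
  have -> : (2 * s1) ^+ p.*2 = 4 ^+ p * s1 ^+ 2 ^+ p.
    by rewrite -mul2n exprM (_ : (2 * s1) ^+ 2 = 4 * s1 ^+ 2) ?exprMn //; ring.
  rewrite ler_wpM2l ?mulr_ge0 ?exprn_ge0 //; first exact: ltW.
  apply: lerXn2r; rewrite ?nnegrE ?expR_ge0 ?addr_ge0 ?(mulr_ge0 _ delta0) //.
  exact: expR_le_1D2x.
rewrite t32 (_ : expR 1 * n%:R * s2 ^+ 2 / s1 ^+ 2 * expR (- s ^+ 3)
  = n%:R * x * (expR 1 * expR (- s ^+ 3))); last by rewrite /x; ring.
apply: le_trans (ler_wpM2l _ thE); last first.
  by apply: mulr_ge0; apply: mulr_ge0; rewrite ?expR_ge0 ?(ltW x0).
apply: (@le_trans _ _ (n%:R * (s1 ^+ 2 ^+ p * (4 ^+ p * x *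
   (expR 1 * expR (- s ^+ 3) * expR (p.*2%:R * delta)))))).
  rewrite ler_wpM2l // ler_wpM2l ?exprn_ge0 ?(ltW s10) //.
  by apply: ler_pM; rewrite ?expR_ge0.
move: (4 ^+ p) (s1 ^+ 2 ^+ p) (expR _) (expR _) (expR _) => a1 a2 e1 e2 e3.
rewrite le_eqVlt; apply/orP; left; apply/eqP; clear; ring.
Qed.
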